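(* Let $\mathcal X_{\mathcal Q_2}$ be the quantum torus with coordinates $Z_{O1},Z_{O2},Z_{B1},Z_{B2},Z_{G1},Z_{G2}$ described in the context and $\mathcal X_{\mathcal Q_2}^{1/2}$ its extension by square roots. The $\mathrm{SL}_2(\mathcal X_{\mathcal Q_2}^{1/2})$ matrices $$\overline O=\begin{pmatrix}0&Z_{O1}^{-1/2}Z_{O2}^{-1}\\-Z_{O1}^{1/2}Z_{O2}&Z_{O1}^{1/2}+Z_{O1}^{-1/2}\end{pmatrix},$$ $$\overline B=\begin{pmatrix}Z_{B1}^{1/2}+Z_{B1}^{-1/2}+Z_{B1}^{-1/2}Z_{B2}^{-1}&Z_{B1}^{1/2}+Z_{B1}^{-1/2}+Z_{B1}^{-1/2}Z_{B2}^{-1}+Z_{B1}^{1/2}Z_{B2}\\-Z_{B1}^{-1/2}Z_{B2}^{-1}&-Z_{B1}^{-1/2}Z_{B2}^{-1}\end{pmatrix},$$ $$\overline G=\begin{pmatrix}Z_{G1}^{1/2}+Z_{G1}^{-1/2}+Z_{G1}^{1/2}Z_{G2}&Z_{G1}^{1/2}Z_{G2}\\-Z_{G1}^{1/2}-Z_{G1}^{-1/2}-Z_{G1}^{-1/2}Z_{G2}^{-1}-Z_{G1}^{1/2}Z_{G2}&-Z_{G1}^{1/2}Z_{G2}\end{pmatrix},$$ $$\overline P=\begin{pmatrix}qZ_{O1}^{1/2}Z_{B1}^{1/2}Z_{G1}^{1/2}Z_{O2}Z_{B2}Z_{G2}&0\\-qz&qZ_{O1}^{-1/2}Z_{B1}^{-1/2}Z_{G1}^{-1/2}Z_{O2}^{-1}Z_{B2}^{-1}Z_{G2}^{-1}\end{pmatrix},$$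 with $$\begin{aligned}z=&\ (Z_{O1}^{1/2}-Z_{O1}^{-1/2})Z_{B1}^{-1/2}Z_{G1}^{-1/2}Z_{B2}^{-1}Z_{G2}^{-1}+(Z_{B1}^{1/2}-Z_{B1}^{-1/2})Z_{G1}^{-1/2}Z_{O1}^{-1/2}Z_{O2}Z_{G2}^{-1}\\&+(Z_{G1}^{1/2}-Z_{G1}^{-1/2})Z_{O1}^{-1/2}Z_{B1}^{-1/2}Z_{O2}Z_{B2}+Z_{O1}^{1/2}Z_{B1}^{1/2}Z_{G1}^{1/2}Z_{O2}Z_{B2}Z_{G2}\\&+Z_{O1}^{1/2}Z_{B1}^{1/2}Z_{G1}^{-1/2}Z_{O2}Z_{B2}Z_{G2}^{-1}+Z_{O1}^{1/2}Z_{B1}^{-1/2}Z_{G1}^{-1/2}Z_{O2}Z_{B2}^{-1}Z_{G2}^{-1},\end{aligned}$$ satisfy the relations (with $\mathbb 1$ the identity matrix) $$(\overline O-Z_{O1}^{1/2}\mathbb 1)(\overline O-Z_{O1}^{-1/2}\mathbb 1)=0,\quad(\overline B-Z_{B1}^{1/2}\mathbb 1)(\overline B-Z_{B1}^{-1/2}\mathbb 1)=0,\quad(\overline G-Z_{G1}^{1/2}\mathbb 1)(\overline G-Z_{G1}^{-1/2}\mathbb 1)=0,$$ $$\big(\overline P-qZ_{O1}^{1/2}Z_{B1}^{1/2}Z_{G1}^{1/2}Z_{O2}Z_{B2}Z_{G2}\mathbb 1\big)\big(\overline P-qZ_{O1}^{-1/2}Z_{B1}^{-1/2}Z_{G1}^{-1/2}Z_{O2}^{-1}Z_{B2}^{-1}Z_{G2}^{-1}\mathbb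 1\big)=0,$$ $$\overline O\,\overline B\,\overline G\,\overline P=q^{-1}\mathbb 1.$$ The map $K_1\mapsto\overline O$, $K_2\mapsto\overline B$, $K_3\mapsto\overline G$, $K_4\mapsto\overline P$, $q\mapsto q^2$ defines an embedding (injective algebra homomorphism) of the universal algebra $\mathsf H_{D_4}$ into $\mathrm{Mat}_2(\mathcal X_{\mathcal Q_2}^{1/2})$.
   Context: $\mathsf H_{D_4}$ is the universal generalized double affine Hecke algebra of type $\tilde D_4$: the algebra over $\mathbb C[t_1^{\pm1},\dots,t_4^{\pm1}]\otimes\mathbb C[q^{\pm1/2}]$ (parameters central) generated by $K_1,\dots,K_4$ with relations $(K_i-t_i)(K_i-t_i^{-1})=0$, $i=1,\dots,4$, and $K_1K_2K_3K_4=q^{-1/2}$. In the embedding, $q^{1/2}\mapsto q$ and the central parameters $t_1,t_2,t_3,t_4$ go to the corresponding Hecke parameters $Z_{O1}^{1/2}$, $Z_{B1}^{1/2}$, $Z_{G1}^{1/2}$, $qZ_{O1}^{1/2}Z_{B1}^{1/2}Z_{G1}^{1/2}Z_{O2}Z_{B2}Z_{G2}$ (times $\mathbb 1$), which are central in $\mathcal X_{\mathcal Q_2}^{1/2}$. The quiver $\mathcal Q_2$ has vertices $Z_{O1},Z_{B1},Z_{G1},Z_{O2},Z_{B2},Z_{G2}$ and exactly three arrows $Z_{O2}\to Z_{G2}\to Z_{B2}\to Z_{O2}$. With $q$ a central invertible indeterminate, $\mathcal X_{\mathcal Q_2}$ is generated by invertible $Z_\alpha$, one per vertex, with $Z_\beta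 Z_\alpha=q^{-2}Z_\alpha Z_\beta$ for each arrow $\alpha\to\beta$ and commutation when there is no arrow. The extension $\mathcal X_{\mathcal Q_2}^{1/2}$ is the $\mathbb C[q^{\pm1/8}]$-algebra generated by invertible $Z_\alpha^{1/2}$ with $Z_\beta^{1/2}Z_\alpha^{1/2}=q^{-1/2}Z_\alpha^{1/2}Z_\beta^{1/2}$ for each arrow $\alpha\to\beta$ and commutation otherwise; $Z_\alpha=(Z_\alpha^{1/2})^2$. In particular $Z_{O1},Z_{B1},Z_{G1}$ and their square roots are central.
   Formalization: In z, the three brackets (for O1, B1, G1) have + instead of −; the second term has Z_{O1}^{1/2} for Z_{O1}^{-1/2}, and the third Z_{O1}^{1/2}Z_{B1}^{1/2} for Z_{O1}^{-1/2}Z_{B1}^{-1/2}; with the printed z the product relation fails (at q=Z=1 it gives 3, not 9). *)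

(* Defs.v *)
From HB Require Import structures.
From mathcomp Require Import all_boot all_order all_algebra.
From mathcomp Require Import boolp reals.
From mathcomp Require Import complex.
From mathcomp Require Import monalg.

Set Implicit Arguments.
Unset Strict Implicit.
Unset Printing Implicit Defensive.

Import GRing.Theory.
Local Open Scope ring_scope.
Local Open Scope quotient_scope.
Local Open Scope complex_scope.

(* Unital associative algebras presented by generators and relations: the     *)
(* quotient of the free algebra {malg K[{fmonom X}]} by the two-sided ideal   *)
(* generated by the differences f - g of the relations rel f g.               *)
(* Since 1 != 0 is not automatic in such a quotient, presAlg is only declared *)
(* as a pzRingType and an lmodType; pres_scaleAl and pres_scaleAr provide the *)
(* compatibility that makes it a K-algebra.                                   *)
Section Presentation.
Variables (K : comNzRingType) (X : choiceType).

Local Notation freeAlg := {malg K[{fmonom X}]}.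

Definition freeGen (x : X) : freeAlg := << fmu x >>%R.

Fact malg_scalerAr (c : K) (f g : freeAlg) : c *: (f * g) = f * (c *: g).
Proof.
have malgC_comm : f * c%:MP = c%:MP * f.
  rewrite !malgM_def fgmulUg fgmulgU; apply: eq_bigr => k _.
  by rewrite mul1m mulm1 mulrC.
have cg : c%:MP * g = c *: g by exact: mul_malgC.
have cfg : c%:MP * (f * g) = c *: (f * g) by exact: mul_malgC.
rewrite -cfg [LHS]mulrA -malgC_comm -[LHS]mulrA.
by congr (_ * _); exact: cg.
Qed.

Variable rel : freeAlg -> freeAlg -> Prop.

Inductive relIdeal : freeAlg -> Prop :=
| relIdeal_rel f g : rel f g -> relIdeal (f - g)
| relIdeal0 : relIdeal 0
| relIdealD f g : relIdeal f -> relIdeal g -> relIdeal (f + g)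
| relIdealM a f b : relIdeal f -> relIdeal (a * f * b).

Lemma relIdealMl a f : relIdeal f -> relIdeal (a * f).
Proof. by move=> If; rewrite -[a * f]mulr1; apply: relIdealM. Qed.

Lemma relIdealMr f b : relIdeal f -> relIdeal (f * b).
Proof. by move=> If; rewrite -[f * b]mul1r mulrA; apply: relIdealM. Qed.

Lemma relIdealN f : relIdeal f -> relIdeal (- f).
Proof. by rewrite -mulN1r; apply: relIdealMl. Qed.

Lemma relIdealZ c f : relIdeal f -> relIdeal (c *: f).
Proof. by rewrite -[f in c *: f]mul1r scalerAl; apply: relIdealMl. Qed.

Definition presEq (f g : freeAlg) : bool := `[< relIdeal (f - g) >].

Lemma presEq_refl : reflexive presEq.
Proof. by move=> f; apply/asboolP; rewrite subrr; constructor. Qed.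

Lemma presEq_sym : symmetric presEq.
Proof.
by move=> f g; apply/asboolP/asboolP => /relIdealN; rewrite opprB.
Qed.

Lemma presEq_trans : transitive presEq.
Proof.
move=> g f h /asboolP fg /asboolP gh; apply/asboolP.
by rewrite -[f](subrK g) -addrA; apply: relIdealD.
Qed.

Canonical presEq_equiv := EquivRel presEq presEq_refl presEq_sym presEq_trans.

Definition presAlg := {eq_quot presEq_equiv}.
HB.instance Definition _ := Choice.on presAlg.
HB.instance Definition _ := EqQuotient.on presAlg.

Lemma presAlgP (f g : freeAlg) :
  (\pi_presAlg f = \pi_presAlg g) <-> relIdeal (f - g).
Proof.
split; first by move/eqmodP/asboolP.
by move=> fg; apply/eqmodP/asboolP.
Qed.

Definition pres_zero : presAlg := lift_cst presAlg 0.
Definition pres_one : presAlg := lift_cst presAlg 1.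
Definition pres_opp := lift_op1 presAlg (@GRing.opp freeAlg).
Definition pres_add := lift_op2 presAlg (@GRing.add freeAlg).
Definition pres_mul := lift_op2 presAlg (@GRing.mul freeAlg).
Definition pres_scale (c : K) :=
  lift_op1 presAlg (fun f : freeAlg => c *: f).

Lemma presPi_repr f : relIdeal (repr (\pi_presAlg f) - f).
Proof. by apply/presAlgP; rewrite reprK. Qed.

Lemma presPi_zero : pres_zero = \pi_presAlg 0.
Proof. by rewrite /pres_zero -lock. Qed.

Lemma presPi_one : pres_one = \pi_presAlg 1.
Proof. by rewrite /pres_one -lock. Qed.

Lemma presPi_opp f : pres_opp (\pi_presAlg f) = \pi_presAlg (- f).
Proof.
rewrite /pres_opp -lock; apply/presAlgP; rewrite -opprD.
by apply: relIdealN; apply: presPi_repr.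
Qed.

Lemma presPi_add f g :
  pres_add (\pi_presAlg f) (\pi_presAlg g) = \pi_presAlg (f + g).
Proof.
rewrite /pres_add -lock; apply/presAlgP; rewrite opprD addrACA.
by apply: relIdealD; apply: presPi_repr.
Qed.

Lemma presPi_mul f g :
  pres_mul (\pi_presAlg f) (\pi_presAlg g) = \pi_presAlg (f * g).
Proof.
rewrite /pres_mul -lock; apply/presAlgP; set f' := repr _; set g' := repr _.
have -> : f' * g' - f * g = (f' - f) * g' + f * (g' - g).
  by rewrite mulrBl mulrBr addrA subrK.
apply: relIdealD; first by apply: relIdealMr; apply: presPi_repr.
by apply: relIdealMl; apply: presPi_repr.
Qed.

Lemma presPi_scale c f : pres_scale c (\pi_presAlg f) = \pi_presAlg (c *: f).
Proof.
rewrite /pres_scale -lock; apply/presAlgP; rewrite -scalerBr.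
by apply: relIdealZ; apply: presPi_repr.
Qed.

Lemma pres_ind (P : presAlg -> Prop) : (forall f, P (\pi_presAlg f)) -> forall x, P x.
Proof. by move=> h x; rewrite -[x]reprK; apply: h. Qed.

Let piE := (presPi_zero, presPi_one, presPi_opp, presPi_add, presPi_mul, presPi_scale).

Fact pres_addA : associative pres_add.
Proof.
by elim/pres_ind=> f; elim/pres_ind=> g; elim/pres_ind=> h; rewrite !piE addrA.
Qed.
Fact pres_addC : commutative pres_add.
Proof. by elim/pres_ind=> f; elim/pres_ind=> g; rewrite !piE addrC. Qed.
Fact pres_add0 : left_id pres_zero pres_add.
Proof. by elim/pres_ind=> f; rewrite !piE add0r. Qed.
Fact pres_addN : left_inverse pres_zero pres_opp pres_add.
Proof. by elim/pres_ind=> f; rewrite !piE addNr. Qed.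
HB.instance Definition _ :=
  GRing.isZmodule.Build presAlg pres_addA pres_addC pres_add0 pres_addN.

Fact pres_mulA : associative pres_mul.
Proof.
by elim/pres_ind=> f; elim/pres_ind=> g; elim/pres_ind=> h; rewrite !piE mulrA.
Qed.
Fact pres_mul1l : left_id pres_one pres_mul.
Proof. by elim/pres_ind=> f; rewrite !piE mul1r. Qed.
Fact pres_mul1r : right_id pres_one pres_mul.
Proof. by elim/pres_ind=> f; rewrite !piE mulr1. Qed.
Fact pres_mulDl : left_distributive pres_mul +%R.
Proof.
elim/pres_ind=> f; elim/pres_ind=> g; elim/pres_ind=> h.
by rewrite /GRing.add /= !piE mulrDl.
Qed.
Fact pres_mulDr : right_distributive pres_mul +%R.
Proof.
elim/pres_ind=> f; elim/pres_ind=> g; elim/pres_ind=> h.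
by rewrite /GRing.add /= !piE mulrDr.
Qed.
HB.instance Definition _ := GRing.Zmodule_isPzRing.Build presAlg
  pres_mulA pres_mul1l pres_mul1r pres_mulDl pres_mulDr.

Fact pres_scaleA a b x :
  pres_scale a (pres_scale b x) = pres_scale (a * b) x.
Proof. by elim/pres_ind: x => f; rewrite !piE scalerA. Qed.
Fact pres_scale1 : left_id 1 pres_scale.
Proof. by elim/pres_ind=> f; rewrite !piE scale1r. Qed.
Fact pres_scaleDr : right_distributive pres_scale +%R.
Proof.
move=> a; elim/pres_ind=> f; elim/pres_ind=> g.
by rewrite /GRing.add /= !piE scalerDr.
Qed.
Fact pres_scaleDl x : {morph pres_scale^~ x : a b / a + b}.
Proof.
move=> a b; elim/pres_ind: x => f.
by rewrite [in RHS]/GRing.add /= !piE scalerDl.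
Qed.
HB.instance Definition _ := GRing.Zmodule_isLmodule.Build K presAlg
  pres_scaleA pres_scale1 pres_scaleDr pres_scaleDl.

Lemma pres_scaleAl (a : K) (x y : presAlg) : a *: (x * y) = a *: x * y.
Proof.
elim/pres_ind: x => f; elim/pres_ind: y => g.
by rewrite /GRing.scale /GRing.mul /= !piE scalerAl.
Qed.

Lemma pres_scaleAr (a : K) (x y : presAlg) : a *: (x * y) = x * (a *: y).
Proof.
elim/pres_ind: x => f; elim/pres_ind: y => g.
by rewrite /GRing.scale /GRing.mul /= !piE malg_scalerAr.
Qed.

Definition presPi (f : freeAlg) : presAlg := \pi_presAlg f.

Fact presPi_is_additive : {morph presPi : f g / f - g}.
Proof.
move=> f g; rewrite /presPi /GRing.opp /GRing.add /=.
by rewrite !piE.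
Qed.
HB.instance Definition _ :=
  GRing.isZmodMorphism.Build freeAlg presAlg presPi presPi_is_additive.

Fact presPi_is_multiplicative : monoid_morphism presPi.
Proof. by split; [exact: esym presPi_one | move=> f g; exact: esym (presPi_mul f g)]. Qed.
HB.instance Definition _ :=
  GRing.isMonoidMorphism.Build freeAlg presAlg presPi presPi_is_multiplicative.

Lemma presPiZ (a : K) f : presPi (a *: f) = a *: presPi f.
Proof. exact: esym (presPi_scale a f). Qed.

Lemma presPi_eq f g : rel f g -> presPi f = presPi g.
Proof. by move=> fg; apply/presAlgP; constructor. Qed.

Definition presGen (x : X) : presAlg := presPi (freeGen x).

End Presentation.

(* H_{D_4} over C = R[i]. The parameters t_i and q^{1/2} are generators too,  *)
(* made central and invertible by the relations, so that the C-algebra below  *)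
(* is the C[t_1^{+-1},..,t_4^{+-1},q^{+-1/2}]-algebra generated by the K_i.   *)
(* The indices 1..4 are represented by 0..3 : 'I_4.                           *)
Inductive hgen :=
  | gK of 'I_4        (* K_i *)
  | gT of 'I_4        (* t_i *)
  | gTV of 'I_4       (* t_i^{-1} *)
  | gQh               (* q^{1/2} *)
  | gQhV.             (* q^{-1/2} *)
HB.instance Definition _ := gen_eqMixin hgen.
HB.instance Definition _ := gen_choiceMixin hgen.

Section HD4.
Variable R : realType.
Local Notation FH := {malg R[i][{fmonom hgen}]}.
Let v : hgen -> FH := @freeGen R[i] hgen.

Inductive hrel : FH -> FH -> Prop :=
| hrel_TTV i : hrel (v (gT i) * v (gTV i)) 1
| hrel_TVT i : hrel (v (gTV i) * v (gT i)) 1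
| hrel_QQV : hrel (v gQh * v gQhV) 1
| hrel_QVQ : hrel (v gQhV * v gQh) 1
| hrel_Tcentral i g : hrel (v (gT i) * v g) (v g * v (gT i))
| hrel_Qcentral g : hrel (v gQh * v g) (v g * v gQh)
| hrel_Hecke i : hrel ((v (gK i) - v (gT i)) * (v (gK i) - v (gTV i))) 0
| hrel_prod :
    hrel (v (gK (inord 0)) * v (gK (inord 1)) *
          v (gK (inord 2)) * v (gK (inord 3))) (v gQhV).

Local Notation HD4 := (presAlg hrel).

Definition hK (i : 'I_4) : HD4 := presGen hrel (gK i).
Definition ht (i : 'I_4) : HD4 := presGen hrel (gT i).
Definition hqh : HD4 := presGen hrel gQh.

End HD4.

Notation HD4 R := (presAlg (@hrel R)).

(* The quiver Q_2. *)
Inductive vertex := O1 | B1 | G1 | O2 | B2 | G2.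

Definition arrow (a b : vertex) : bool :=
  match a, b with
  | O2, G2 | G2, B2 | B2, O2 => true
  | _, _ => false
  end.

(* The extended quantum torus, again as a C-algebra in which q^{1/8} is a     *)
(* central invertible generator; q^{-1/2} is (q^{-1/8})^4 and q is            *)
(* (q^{1/8})^8.                                                               *)
Inductive xgen :=
  | gZ of vertex      (* Z_a^{1/2} *)
  | gZV of vertex     (* Z_a^{-1/2} *)
  | gQ8               (* q^{1/8} *)
  | gQ8V.             (* q^{-1/8} *)
HB.instance Definition _ := gen_eqMixin xgen.
HB.instance Definition _ := gen_choiceMixin xgen.

Section QuantumTorus.
Variable R : realType.
Local Notation FX := {malg R[i][{fmonom xgen}]}.
Let v : xgen -> FX := @freeGen R[i] xgen.

Inductive xrel : FX -> FX -> Prop :=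
| xrel_ZZV a : xrel (v (gZ a) * v (gZV a)) 1
| xrel_ZVZ a : xrel (v (gZV a) * v (gZ a)) 1
| xrel_QQV : xrel (v gQ8 * v gQ8V) 1
| xrel_QVQ : xrel (v gQ8V * v gQ8) 1
| xrel_Qcentral g : xrel (v gQ8 * v g) (v g * v gQ8)
| xrel_arrow a b : arrow a b ->
    xrel (v (gZ b) * v (gZ a)) (v gQ8V ^+ 4 * v (gZ a) * v (gZ b))
| xrel_comm a b : ~~ arrow a b -> ~~ arrow b a ->
    xrel (v (gZ b) * v (gZ a)) (v (gZ a) * v (gZ b)).

Local Notation XQ2 := (presAlg xrel).

Definition Zh (a : vertex) : XQ2 := presGen xrel (gZ a).
Definition ZhV (a : vertex) : XQ2 := presGen xrel (gZV a).
Definition Z (a : vertex) : XQ2 := Zh a ^+ 2.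
Definition ZV (a : vertex) : XQ2 := ZhV a ^+ 2.
Definition xq : XQ2 := presGen xrel gQ8 ^+ 8.
Definition xqV : XQ2 := presGen xrel gQ8V ^+ 8.

Definition mx2 (a b c d : XQ2) : 'M[XQ2]_2 :=
  \matrix_(i < 2, j < 2)
    if i == ord0 then (if j == ord0 then a else b)
    else (if j == ord0 then c else d).

Definition Obar : 'M[XQ2]_2 :=
  mx2 0                  (ZhV O1 * ZV O2)
      (- (Zh O1 * Z O2)) (Zh O1 + ZhV O1).

Definition Bbar : 'M[XQ2]_2 :=
  mx2 (Zh B1 + ZhV B1 + ZhV B1 * ZV B2)
      (Zh B1 + ZhV B1 + ZhV B1 * ZV B2 + Zh B1 * Z B2)
      (- (ZhV B1 * ZV B2))
      (- (ZhV B1 * ZV B2)).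

Definition Gbar : 'M[XQ2]_2 :=
  mx2 (Zh G1 + ZhV G1 + Zh G1 * Z G2)
      (Zh G1 * Z G2)
      (- Zh G1 - ZhV G1 - ZhV G1 * ZV G2 - Zh G1 * Z G2)
      (- (Zh G1 * Z G2)).

Definition tinf : XQ2 := xq * Zh O1 * Zh B1 * Zh G1 * Z O2 * Z B2 * Z G2.
Definition tinfV : XQ2 := xq * ZhV O1 * ZhV B1 * ZhV G1 * ZV O2 * ZV B2 * ZV G2.

(* zP is the (2,1) entry of Obar * Bbar * Gbar, which is the only value for   *)
(* which Obar * Bbar * Gbar * Pbar = q^{-1}. In print its first three terms   *)
(* carry Z_{O1}^{1/2} - Z_{O1}^{-1/2}, Z_{B1}^{1/2} - Z_{B1}^{-1/2} and       *)
(* Z_{G1}^{1/2} - Z_{G1}^{-1/2}, the second one Z_{O1}^{-1/2}, and the third  *)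
(* one Z_{O1}^{-1/2} Z_{B1}^{-1/2}; with those, the relation is false: when   *)
(* q and all Z_a are specialized to 1, Obar * Bbar * Gbar has (2,1) entry 9,  *)
(* while the printed expression takes the value 3.                            *)
Definition zP : XQ2 :=
    (Zh O1 + ZhV O1) * ZhV B1 * ZhV G1 * ZV B2 * ZV G2
  + (Zh B1 + ZhV B1) * ZhV G1 * Zh O1 * Z O2 * ZV G2
  + (Zh G1 + ZhV G1) * Zh O1 * Zh B1 * Z O2 * Z B2
  + Zh O1 * Zh B1 * Zh G1 * Z O2 * Z B2 * Z G2
  + Zh O1 * Zh B1 * ZhV G1 * Z O2 * Z B2 * ZV G2
  + Zh O1 * ZhV B1 * ZhV G1 * Z O2 * ZV B2 * ZV G2.

Definition Pbar : 'M[XQ2]_2 :=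
  mx2 tinf          0
      (- (xq * zP)) tinfV.

End QuantumTorus.

Notation XQ2 R := (presAlg (@xrel R)).

Arguments hK R i : clear implicits.
Arguments ht R i : clear implicits.
Arguments Zh R a : clear implicits.
Arguments ZhV R a : clear implicits.

(* Main.v *)
Require Import Defs.
From HB Require Import structures.
From mathcomp Require Import all_fingroup all_boot all_order all_algebra.
From mathcomp Require Import boolp reals.
From mathcomp Require Import complex.
From mathcomp Require Import finmap monalg.
From mathcomp Require Import zify ring ssrAC.

Import Order.TTheory GRing.Theory Num.Theory.
Local Open Scope ring_scope.
Local Open Scope complex_scope.
Set Implicit Arguments.
Unset Strict Implicit.
Unset Printing Implicit Defensive.

(** The determinants and the five relations are 2-by-2 computations. A matrix with determinant 1 and
    central trace x + y, x y = 1, satisfies its quadratic relation by Cayley-Hamilton as soon as its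
    entries commute well enough ([quadratic22]). The product of the first three matrices is lower
    triangular, and the fourth is a power of q times its inverse ([OBGmxE], [OBGPmx]). The universal
    property of a presented algebra ([presAlg_universal]) then gives the homomorphism
    ([HD4_morphism], [torus_representation]).

    Injectivity combines a spanning set upstairs with linear independence of its image.

    Spanning: K_4 is expressed through K_1, K_2, K_3, and the remaining relation K_4 + K_4^{-1} =
    t_4 + t_4^{-1} becomes a cyclically symmetric identity ([hexagon]). Modulo shorter words it
    exchanges K_{i-1} K_i K_{i+1} and K_{i+1} K_i K_{i-1} up to q^2 ([hk_swap]), while the Hecke
    relations shorten squares. By pure combinatorics of words ([resolves_all]), every element is a
    combination of central monomials times sorted words ([hspan_word], [HD4_span]).

    Independence: the torus acts by twisted translations on functions on a lattice
    ([torus_operators]), so distinct monomials can be told apart; it suffices that the composite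
    [Psi] with this action is injective. In the degree in Z_{O2}, Z_{B2}, Z_{G2}, each K_i with i =
    1, 2, 3 has as leading term a monomial times an integer matrix of rank one, and in a word
    without repeated neighbours these multiply without cancellation ([wmx_top]). Sorted words whose
    leading monomials agree up to central parameters have linearly independent leading matrices,
    separated by explicit functionals ([dual_self], [dual_orth]). Testing a vanishing combination at
    an index of maximal degree kills its coefficient ([Psi_injective]). *)

(** * Universal property of algebras given by generators and relations *)

Section Universal.
Variables (K : comNzRingType) (X : choiceType).
Local Notation freeAlg := {malg K[{fmonom X}]}.

Lemma freeAlg_ind (P : freeAlg -> Prop) :
  P 0 -> P 1 -> (forall f g, P f -> P g -> P (f + g)) ->
  (forall c f, P f -> P (c *: f)) ->
  (forall x f, P f -> P (freeGen K x * f)) -> forall f, P f.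
Proof.
move=> P0 P1 PD PZ PM f; rewrite [f]monalgE.
elim/big_rec: _ => // m g _ Pg; apply: PD => //.
have -> : << f@_m *g m >> = f@_m *: << m >> :> freeAlg.
  by rewrite -mul_malgC malgM_def fgmulUU mulr1 mul1m.
apply: PZ; case: m => s; rewrite -fmE.
elim: s => [|x s IHs]; first exact: P1.
have -> : << fmonom_of_seq fmonom_key (x :: s) >> =
          freeGen K x * << fmonom_of_seq fmonom_key s >> :> freeAlg.
  rewrite malgM_def fgmulUU mulr1; congr (<< _ >>).
  by apply/val_inj; rewrite /= /mmul /= /fmmul /fmu !fmE.
exact: PM.
Qed.

Variables (S : pzRingType) (iota : {rmorphism K -> S}) (g : X -> S).
Hypothesis iotaC : forall c x, iota c * g x = g x * iota c.

Definition monEval (m : {fmonom X}) : S := \prod_(x <- (m : seq X)) g x.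

Definition freeEval (f : freeAlg) : S :=
  \sum_(m <- msupp f) iota f@_m * monEval m.

Lemma freeEvalEw (d : {fset {fmonom X}}) f : (msupp f `<=` d)%fset ->
  freeEval f = \sum_(m <- d) iota f@_m * monEval m.
Proof.
move=> le; rewrite /freeEval (big_fset_incl _ le) // => m _ /mcoeff_outdom ->.
by rewrite rmorph0 mul0r.
Qed.

Lemma freeEvalD : {morph freeEval : f h / f + h}.
Proof.
move=> f h; pose d := (msupp f `|` msupp h)%fset.
rewrite (@freeEvalEw d f) ?fsubsetUl // (@freeEvalEw d h) ?fsubsetUr //.
rewrite (@freeEvalEw d (f + h)) ?msuppD_le // -big_split /=.
by apply: eq_bigr => m _; rewrite mcoeffD rmorphD mulrDl.
Qed.

Lemma freeEvalZ c f : freeEval (c *: f) = iota c * freeEval f.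
Proof.
rewrite (@freeEvalEw (msupp f) (c *: f)) ?msuppZ_le // mulr_sumr.
by apply: eq_bigr => m _; rewrite mcoeffZ rmorphM mulrA.
Qed.

Lemma freeEval0 : freeEval 0 = 0.
Proof. by rewrite /freeEval msupp0 big_seq_fset0. Qed.

Lemma freeEvalU c m : freeEval << c *g m >> = iota c * monEval m.
Proof.
by rewrite (@freeEvalEw [fset m]%fset) ?msuppU_le // big_seq_fset1 mcoeffUU.
Qed.

Lemma freeEval1 : freeEval 1 = 1.
Proof.
have -> : 1 = << 1 *g mone >> :> freeAlg by [].
by rewrite [LHS]freeEvalU rmorph1 mul1r /monEval fm1 big_nil.
Qed.

Lemma freeEval_gen x : freeEval (freeGen K x) = g x.
Proof.
by rewrite [LHS]freeEvalU rmorph1 mul1r /monEval /fmu fmE big_seq1.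
Qed.

Lemma freeEvalMgen x f : freeEval (freeGen K x * f) = g x * freeEval f.
Proof.
rewrite [in LHS](monalgE f) mulr_sumr (big_morph _ freeEvalD freeEval0).
rewrite /freeEval mulr_sumr; apply: eq_bigr => m _.
have -> : freeGen K x * << f@_m *g m >> = << f@_m *g mmul (fmu x) m >> :> freeAlg.
  by rewrite malgM_def fgmulUU mul1r.
rewrite [LHS]freeEvalU mulrA -iotaC -mulrA; congr (_ * _).
by rewrite /monEval /= /mmul /= /fmmul /fmu !fmE /= big_cons.
Qed.

Lemma freeEvalM : {morph freeEval : f h / f * h}.
Proof.
move=> f h; elim/freeAlg_ind: f => [||f1 f2 I1 I2|c f I|x f I].
- by rewrite mul0r freeEval0 mul0r.
- by rewrite mul1r freeEval1 mul1r.
- by rewrite (mulrDl f1) (freeEvalD (f1 * h)) I1 I2 (freeEvalD f1) [RHS]mulrDl.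
- by rewrite -(scalerAl c f) (freeEvalZ c (f * h)) I (freeEvalZ c f) [LHS]mulrA.
- by rewrite -(mulrA _ f) (freeEvalMgen x (f * h)) I (freeEvalMgen x f) [LHS]mulrA.
Qed.

Variable rel : freeAlg -> freeAlg -> Prop.
Hypothesis relE : forall f h, rel f h -> freeEval f = freeEval h.

Lemma freeEvalN f : freeEval (- f) = - freeEval f.
Proof. by rewrite -scaleN1r freeEvalZ rmorphN1 mulN1r. Qed.

Lemma freeEval_relIdeal f : relIdeal rel f -> freeEval f = 0.
Proof.
elim=> [f1 f2 /relE E||f1 f2 _ I1 _ I2|a f1 b _ I].
- by rewrite freeEvalD freeEvalN E subrr.
- exact: freeEval0.
- by rewrite freeEvalD I1 I2 addr0.
- by rewrite !freeEvalM I mulr0 mul0r.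
Qed.

Definition presEval (x : presAlg rel) : S := freeEval (repr x).

Lemma presEval_pi f : presEval (presPi rel f) = freeEval f.
Proof.
apply/eqP; rewrite -subr_eq0 -freeEvalN -freeEvalD; apply/eqP.
by apply: freeEval_relIdeal; apply: presPi_repr.
Qed.

Lemma presPi_surj (x : presAlg rel) : exists f, x = presPi rel f.
Proof. by exists (repr x); rewrite /presPi reprK. Qed.

Fact presEval_is_zmod : {morph presEval : x y / x - y}.
Proof.
move=> x y; have [f ->] := presPi_surj x; have [h ->] := presPi_surj y.
by rewrite -rmorphB !presEval_pi freeEvalD freeEvalN.
Qed.

Fact presEval_is_monoid : monoid_morphism presEval.
Proof.
split; first by rewrite -(rmorph1 (presPi rel)) presEval_pi freeEval1.
move=> x y; have [f ->] := presPi_surj x; have [h ->] := presPi_surj y.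
by rewrite -rmorphM !presEval_pi freeEvalM.
Qed.

(** Evaluate a representative in the free algebra; the relation ideal evaluates to 0. The target is
    a bare ring, so scalars enter through [iota], which need only commute with the images of the
    generators. *)
Lemma presAlg_universal : exists2 F : {rmorphism presAlg rel -> S},
  forall x, F (presGen rel x) = g x & forall c x, F (c *: x) = iota c * F x.
Proof.
(* The morphism structure is packed locally because it exists only under the hypotheses of the
   section. *)
pose F1 := GRing.isZmodMorphism.Build _ _ _ presEval_is_zmod.
pose F2 := GRing.isMonoidMorphism.Build _ _ _ presEval_is_monoid.
pose F : {rmorphism presAlg rel -> S} := HB.pack presEval F1 F2.
exists F => [x|c x]; first by rewrite /= presEval_pi freeEval_gen.
have [f ->] := presPi_surj x.
by rewrite -presPiZ /= !presEval_pi freeEvalZ.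
Qed.

End Universal.

Section PresentationTheory.
Variables (K : comNzRingType) (X : choiceType).
Variable rel : {malg K[{fmonom X}]} -> {malg K[{fmonom X}]} -> Prop.
Local Notation A := (presAlg rel).

Lemma presAlg_ind (P : A -> Prop) :
  P 0 -> P 1 -> (forall x y, P x -> P y -> P (x + y)) ->
  (forall c x, P x -> P (c *: x)) ->
  (forall g x, P x -> P (presGen rel g * x)) -> forall x, P x.
Proof.
move=> P0 P1 PD PZ PM x; rewrite -[x]reprK; move: (repr x) => {x} f.
rewrite -/(presPi rel f); elim/freeAlg_ind: f => [||f h If Ih|c f If|g f If].
- by rewrite rmorph0.
- by rewrite rmorph1.
- by rewrite rmorphD; apply: PD.
- by rewrite presPiZ; apply: PZ.
- by rewrite rmorphM; apply: PM.
Qed.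

Lemma presAlg_central (z : A) :
  (forall g, GRing.comm z (presGen rel g)) -> forall x, GRing.comm z x.
Proof.
move=> zg; elim/presAlg_ind => [||x y|c x|g x].
- exact: commr0.
- exact: commr1.
- exact: commrD.
- by rewrite /GRing.comm -pres_scaleAr => ->; rewrite -pres_scaleAl.
- exact: commrM.
Qed.
End PresentationTheory.

(** * Combinatorics of words in three cyclically ordered letters *)

Inductive letter := L0 | L1 | L2.

Definition letter_eq x y :=
  match x, y with L0, L0 | L1, L1 | L2, L2 => true | _, _ => false end.
Lemma letter_eqP : Equality.axiom letter_eq.
Proof. by case=> -[]; constructor. Qed.
HB.instance Definition _ := hasDecEq.Build letter letter_eqP.

(** The letters stand for K_1, K_2, K_3. Only their cyclic order matters, since the hexagon relation
    is invariant under rotation. *)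
Definition nx b := match b with L0 => L1 | L1 => L2 | L2 => L0 end.
Definition pv b := match b with L0 => L2 | L1 => L0 | L2 => L1 end.

Lemma nxK : cancel nx pv. Proof. by case. Qed.
Lemma pvK : cancel pv nx. Proof. by case. Qed.
Lemma pvpv b : pv (pv b) = nx b. Proof. by case: b. Qed.

Fixpoint pw (x y : letter) m : seq letter :=
  if m is m'.+1 then x :: y :: pw x y m' else [::].

(* A word that alternates between a fixed letter [b] and the letters [pv b],  *)
(* [nx b], all [pv b] before all [nx b]. The letters C and X in the names     *)
(* tell whether the first and the last letter is the centre [b] or not.       *)
Inductive sword :=
  | SId
  | SCC of letter & nat & nat
  | SXC of letter & nat & nat
  | SCX0 of letter & nat
  | SCX of letter & nat & nat
  | SXX of letter & nat & nat.

Definition swordXX b m n :=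
  pw (pv b) b m.+1 ++ pw (nx b) b n ++ [:: nx b].

Definition sword_seq s : seq letter :=
  match s with
  | SId => [::]
  | SCC b m n => b :: pw (pv b) b m ++ pw (nx b) b n
  | SXC b m n => pw (pv b) b m.+1 ++ pw (nx b) b n
  | SCX0 b m => pw b (pv b) m.+1
  | SCX b m n => b :: swordXX b m n
  | SXX b m n => swordXX b m n
  end.

(** Swaps preserve the length of a word and will turn out to be harmless modulo shorter words. A
    word resolves if swaps lead it to a sorted word, or to a word with a square, which can be
    shortened. *)
Inductive resolves : seq letter -> Prop :=
  | resolves_sorted s : resolves (sword_seq s)
  | resolves_sq u x v : resolves (u ++ x :: x :: v)
  | resolves_swap u b v : resolves (u ++ [:: pv b, b, nx b & v]) ->
      resolves (u ++ [:: nx b, b, pv b & v])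
  | resolves_swapV u b v : resolves (u ++ [:: nx b, b, pv b & v]) ->
      resolves (u ++ [:: pv b, b, nx b & v]).

Lemma pw_shift x y m v : pw x y m ++ x :: v = x :: pw y x m ++ v.
Proof. by elim: m v => //= m IHm v; rewrite IHm. Qed.

Lemma pw_shift2 x y m v : pw x y m ++ x :: y :: v = x :: y :: pw x y m ++ v.
Proof. by rewrite pw_shift /=; congr (_ :: _); rewrite pw_shift. Qed.

Lemma resolves_move u b m v :
  resolves (u ++ pw (pv b) b m ++ [:: nx b, b & v]) ->
  resolves (u ++ [:: nx b, b & pw (pv b) b m ++ v]).
Proof.
elim: m u => // m IHm u /= h; apply: resolves_swap.
by have := IHm (u ++ [:: pv b; b]); rewrite -!catA; apply.
Qed.

Lemma resolves_moveV u b m v :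
  resolves (u ++ [:: nx b, b & pw (pv b) b m ++ v]) ->
  resolves (u ++ pw (pv b) b m ++ [:: nx b, b & v]).
Proof.
elim: m u => // m IHm u /= h.
have := IHm (u ++ [:: pv b; b]); rewrite -!catA; apply.
exact: resolves_swapV.
Qed.

Lemma letterP b (P : letter -> Prop) : P b -> P (pv b) -> P (nx b) -> forall x, P x.
Proof. by case: b => hb hp hn []. Qed.

(** The new letter either extends the sorted pattern, or repeats the first letter, or travels by
    swaps through a block until it finds its place or meets an equal letter. *)
Lemma resolves_cons_sorted x s : resolves (x :: sword_seq s).
Proof.
have sq y v : resolves (y :: y :: v) by apply: (resolves_sq [::]).
case: s => [|b m n|b m n|b m|b m n|b m n].
- exact: (resolves_sorted (SCC x 0 0)).
- elim/(letterP (b := b)): x => //=; first exact: (resolves_sorted (SXC b m n)).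
  apply: (resolves_move (u := [::])); case: m => [|m] /=.
    by have := resolves_sorted (SCX0 (nx b) n); rewrite /= nxK.
  exact: (resolves_sorted (SXC b m n.+1)).
- elim/(letterP (b := b)): x; [exact: (resolves_sorted (SCC b m.+1 n))|exact: sq|].
  rewrite [sword_seq _]/=; case: n => [|n].
    (* With no block of [nx b] left, the word is already sorted, but about the centre [pv b]. *)
    have := resolves_sorted (SXX (pv b) 0 m).
    by rewrite /= /swordXX /= pvK pvpv pw_shift.
  by apply: (resolves_moveV (u := [:: nx b]) (m := m.+1)); apply: sq.
- elim/(letterP (b := b)): x; first exact: sq.
    by have := resolves_sorted (SCC (pv b) 0 m.+1); rewrite /= pvK.
  rewrite [sword_seq _]/=; have := pw_shift (pv b) b m [::]; rewrite cats0 => <-.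
  apply: (resolves_move (u := [::])) => /=; apply: resolves_swap.
  by have := resolves_sorted (SXX b m 0); rewrite /= /swordXX /= pw_shift2.
- elim/(letterP (b := b)): x; first exact: sq.
    exact: (resolves_sorted (SXX b m.+1 n)).
  apply: (resolves_move (u := [::]) (m := m.+1)).
  exact: (resolves_sorted (SXX b m n.+1)).
- elim/(letterP (b := b)): x; [exact: (resolves_sorted (SCX b m n))|exact: sq|].
  rewrite /= /swordXX; case: n => [|n]; last first.
    by apply: (resolves_moveV (u := [:: nx b]) (m := m.+1)); apply: sq.
  rewrite /= -(pw_shift2 (pv b) b m [:: nx b]) -cat_cons.
  apply: resolves_swapV.
  by apply: (resolves_moveV (u := [:: nx b])); apply: sq.
Qed.

Lemma resolves_cons x s : resolves s -> resolves (x :: s).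
Proof.
elim=> [t|u y v|u b v _|u b v _].
- exact: resolves_cons_sorted.
- exact: (resolves_sq (x :: u)).
- exact: (resolves_swap (u := x :: u)).
- exact: (resolves_swapV (u := x :: u)).
Qed.

Lemma resolves_all s : resolves s.
Proof.
elim: s => [|x s]; [exact: (resolves_sorted SId)|exact: resolves_cons].
Qed.

(** * A spanning set for the algebra: central monomials times sorted words *)

Section IntegerPowers.
Variables (A : pzRingType).

(* The integer power of an invertible [x] with explicit inverse [y]. *)
Definition zpow (x y : A) (n : int) : A :=
  match n with Posz n => x ^+ n | Negz n => y ^+ n.+1 end.

Lemma zpowS (x y : A) n : x * y = 1 -> zpow x y (n + 1) = x * zpow x y n.
Proof.
move=> xy; case: n => [n|[|n]]; first by rewrite -PoszD addn1 /= exprS.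
  by rewrite /= expr1 xy.
have -> : (Negz n.+1 + 1 = Negz n)%R by lia.
by rewrite /= [in RHS]exprS mulrA xy mul1r.
Qed.

Lemma zpowP (x y : A) n : y * x = 1 -> zpow x y (n - 1) = y * zpow x y n.
Proof.
move=> yx; case: n => [[|n]|n]; first by rewrite /= mulr1 expr1.
  have -> : (Posz n.+1 - 1 = Posz n)%R by lia.
  by rewrite /= exprS mulrA yx mul1r.
by have -> : (Negz n - 1 = Negz n.+1)%R by lia.
Qed.

Lemma comm_zpow (x y z : A) n :
  GRing.comm z x -> GRing.comm z y -> GRing.comm z (zpow x y n).
Proof. by move=> zx zy; case: n => n; apply: commrX. Qed.

End IntegerPowers.

Definition ltr_ord (x : letter) : 'I_4 :=
  match x with L0 => inord 0 | L1 => inord 1 | L2 => inord 2 end.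

Lemma ord4_ind (P : 'I_4 -> Prop) : (forall x, P (ltr_ord x)) -> P (inord 3) -> forall i, P i.
Proof.
move=> Pl P3 i; rewrite -(inord_val i); case: i => [[|[|[|[|m]]]] ltm] //=.
- exact: (Pl L0).
- exact: (Pl L1).
- exact: (Pl L2).
Qed.

Lemma comm_inv (A : pzRingType) (x y z : A) :
  x * y = 1 -> y * x = 1 -> GRing.comm x z -> GRing.comm y z.
Proof.
move=> xy yx xz; rewrite /GRing.comm -[y * z]mulr1 -xy mulrA -[y * z * x]mulrA -xz.
by rewrite mulrA yx mul1r.
Qed.

Lemma central_expand (A : pzRingType) (X Y Z x y z : A) :
  (forall u, GRing.comm X u) -> (forall u, GRing.comm Y u) -> (forall u, GRing.comm Z u) ->
  (Z - z) * (Y - y) * (X - x) =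
  X * (Y * (Z * 1)) - Y * (Z * x) - X * (Z * y) - X * (Y * z)
  + Z * (y * x) + Y * (z * x) + X * (z * y) - z * y * x.
Proof.
move=> Xc Yc Zc.
have -> : (Z - z) * (Y - y) = Y * Z - Z * y - Y * z + z * y.
  rewrite mulrBr !mulrBl -(Yc Z) -(Yc z) opprB addrA.
  by rewrite [LHS](ACl (1*4*2*3)).
rewrite mulrBr -(Xc (_ + _)) !(mulrDr X, mulrDl _ _ x) !(mulrN, mulNr) -!mulrA mulr1.
rewrite !opprD !opprK !addrA.
by rewrite [LHS](ACl (1*5*2*3*6*7*4*8)).
Qed.

Section HeckeAlgebra.
Variables (H : pzRingType) (K t tV : 'I_4 -> H) (q qV : H).
Hypothesis t_tV : forall i, t i * tV i = 1.
Hypothesis tV_t : forall i, tV i * t i = 1.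
Hypothesis q_qV : q * qV = 1.
Hypothesis qV_q : qV * q = 1.
Hypothesis t_central : forall i x, GRing.comm (t i) x.
Hypothesis q_central : forall x, GRing.comm q x.
Hypothesis K_Hecke : forall i, (K i - t i) * (K i - tV i) = 0.
Hypothesis K_prod :
  K (inord 0) * K (inord 1) * K (inord 2) * K (inord 3) = qV.

Definition hk (x : letter) : H := K (ltr_ord x).
Definition hT (i : 'I_4) : H := t i + tV i.

Lemma tV_central i x : GRing.comm (tV i) x.
Proof. exact: comm_inv (t_tV i) (tV_t i) (t_central i x). Qed.

Lemma qV_central x : GRing.comm qV x.
Proof. exact: comm_inv q_qV qV_q (q_central x). Qed.

Lemma hT_central i x : GRing.comm (hT i) x.
Proof. by rewrite /GRing.comm mulrDl mulrDr t_central tV_central. Qed.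

Lemma K_sq i : K i * K i = hT i * K i - 1.
Proof.
have := K_Hecke i; rewrite mulrBl !mulrBr t_tV -(tV_central i (K i)).
move/eqP; rewrite subr_eq0 subr_eq => /eqP ->.
by rewrite mulrDl addrAC.
Qed.

(** By the Hecke relation the inverse of a generator is affine in it, so products of inverses expand
    into words. *)
Definition hkV x : H := hT (ltr_ord x) - hk x.

Lemma hk_hkV x : hk x * hkV x = 1.
Proof. by rewrite mulrBr -hT_central K_sq opprB addrC subrK. Qed.

Lemma hkV_hk x : hkV x * hk x = 1.
Proof. by rewrite mulrBl K_sq opprB addrC subrK. Qed.

Local Notation P := (K (inord 3)).
Local Notation T4 := (hT (inord 3)).

(* [q k0 k1 k2] is the inverse of [K_4], hence equals [T4 - K_4]. *)
Lemma K3E : P = T4 - q * (hk L0 * hk L1 * hk L2).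
Proof.
have yP : q * (hk L0 * hk L1 * hk L2) * P = 1.
  by rewrite -mulrA K_prod q_qV.
have PV : P * (T4 - P) = 1 by rewrite mulrBr -hT_central K_sq opprB addrC subrK.
rewrite -[q * _]mulr1 -PV mulrA yP mul1r opprB addrC subrK //.
Qed.

(** This is K_4^{-1} + K_4 = t_4 + t_4^{-1}, both summands rewritten in K_1, K_2, K_3 by the product
    relation. *)
Lemma hexagon_base :
  q * (hk L0 * hk L1 * hk L2) + qV * (hkV L2 * hkV L1 * hkV L0) = T4.
Proof.
set y := q * _.
have Py : P * y = 1.
  have yP : y * P = 1 by rewrite -mulrA K_prod q_qV.
  have PV : P * (T4 - P) = 1 by rewrite mulrBr -hT_central K_sq opprB addrC subrK.
  by have -> : y = T4 - P by rewrite -[y]mulr1 -PV mulrA yP mul1r.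
have yV : y * (qV * (hkV L2 * hkV L1 * hkV L0)) = 1.
  set W := _ * hkV L0; have MW : hk L0 * hk L1 * hk L2 * W = 1.
    rewrite /W -!mulrA [hk L2 * _]mulrA hk_hkV mul1r [hk L1 * _]mulrA hk_hkV mul1r.
    by rewrite hk_hkV.
  by rewrite /y -mulrA (mulrA _ qV) -(qV_central (_ * hk L2)) -mulrA MW mulr1.
rewrite -[qV * _]mul1r -Py -mulrA yV mulr1 addrC {1}K3E subrK //.
Qed.

(** Conjugate by [hk x]: the right-hand side is central and the two products rotate. *)
Lemma hexagon_rot x y z :
  q * (hk x * hk y * hk z) + qV * (hkV z * hkV y * hkV x) = T4 ->
  q * (hk y * hk z * hk x) + qV * (hkV x * hkV z * hkV y) = T4.
Proof.
move=> E; rewrite -[RHS]mulr1 -(hkV_hk x) [RHS]mulrA (hT_central _ (hkV x)) -E.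
rewrite [X in _ = X * _]mulrDr [RHS]mulrDl; congr (_ + _).
  by rewrite (mulrA (hkV x) q) -(q_central (hkV x)) -!mulrA [hkV x * _]mulrA hkV_hk mul1r.
rewrite (mulrA (hkV x) qV) -(qV_central (hkV x)) -!mulrA.
by rewrite hkV_hk mulr1.
Qed.

Lemma hexagon b :
  q * (hk (pv b) * hk b * hk (nx b)) + qV * (hkV (nx b) * hkV b * hkV (pv b)) = T4.
Proof.
by case: b => /=; do ?[exact: hexagon_base | apply: hexagon_rot].
Qed.

(** The terms with at most two letters in the expanded hexagon relation. Central factors stand on
    the left and a trailing 1 is kept, so that [low_rest] can peel every term in the same way. *)
Definition hexagon_rest b : H :=
  let x := pv b in let z := nx b in let T y := hT (ltr_ord y) in
  T x * (T b * (T z * 1)) - T b * (T z * hk x) - T x * (T z * hk b) - T x * (T b * hk z)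
  + T z * (hk b * hk x) + T b * (hk z * hk x) + T x * (hk z * hk b) - q * (T4 * 1).

Lemma hkV_expand x y z : let T y := hT (ltr_ord y) in
  hkV z * hkV y * hkV x =
  T x * (T y * (T z * 1)) - T y * (T z * hk x) - T x * (T z * hk y) - T x * (T y * hk z)
  + T z * (hk y * hk x) + T y * (hk z * hk x) + T x * (hk z * hk y) - hk z * hk y * hk x.
Proof. by apply: central_expand => u; apply: hT_central. Qed.

(** Multiply the hexagon relation by q and expand the inverses: the only other word of length three
    is the reversed one. *)
Lemma hk_swap b :
  hk (nx b) * hk b * hk (pv b) =
  q * (q * (hk (pv b) * hk b * hk (nx b))) + hexagon_rest b.
Proof.
have /(congr1 (fun u => q * u)) := hexagon b.
rewrite [LHS]mulrDr [q * (qV * _)]mulrA q_qV mul1r hkV_expand.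
move: (q * (q * _)) => u; rewrite addrA => /eqP; rewrite subr_eq => /eqP E.
by rewrite /hexagon_rest (mulr1 T4) addrA E addrAC subrr add0r.
Qed.


Definition hmon (p : int * int * int * int * int) : H :=
  let: (a, b, c, d, e) := p in
  zpow (t (ltr_ord L0)) (tV (ltr_ord L0)) a * (zpow (t (ltr_ord L1)) (tV (ltr_ord L1)) b *
  (zpow (t (ltr_ord L2)) (tV (ltr_ord L2)) c * (zpow (t (inord 3)) (tV (inord 3)) d *
  zpow q qV e))).

Lemma hmon0 : hmon (0, 0, 0, 0, 0) = 1.
Proof. by rewrite /hmon /= !mulr1. Qed.

Definition shiftable (z : H) := forall p, exists p', z * hmon p = hmon p'.

Lemma central_mulCA (z x y : H) : GRing.comm z x -> z * (x * y) = x * (z * y).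
Proof. by move=> zx; rewrite mulrA zx mulrA. Qed.

Lemma shiftable_t i : shiftable (t i) /\ shiftable (tV i).
Proof.
have ct j x y := @central_mulCA (t j) x y (t_central j x).
have ctV j x y := @central_mulCA (tV j) x y (tV_central j x).
elim/ord4_ind: i => [[]|]; split=> -[[[[a b] c] d] e].
- by exists (a + 1, b, c, d, e); rewrite /hmon zpowS // -!mulrA.
- by exists (a - 1, b, c, d, e); rewrite /hmon zpowP // -!mulrA.
- exists (a, b + 1, c, d, e); rewrite /hmon zpowS // -!mulrA.
  by do 1!(rewrite [LHS]ct; congr (_ * _)).
- exists (a, b - 1, c, d, e); rewrite /hmon zpowP // -!mulrA.
  by do 1!(rewrite [LHS]ctV; congr (_ * _)).
- exists (a, b, c + 1, d, e); rewrite /hmon zpowS // -!mulrA.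
  by do 2!(rewrite [LHS]ct; congr (_ * _)).
- exists (a, b, c - 1, d, e); rewrite /hmon zpowP // -!mulrA.
  by do 2!(rewrite [LHS]ctV; congr (_ * _)).
- exists (a, b, c, d + 1, e); rewrite /hmon zpowS // -!mulrA.
  by do 3!(rewrite [LHS]ct; congr (_ * _)).
- exists (a, b, c, d - 1, e); rewrite /hmon zpowP // -!mulrA.
  by do 3!(rewrite [LHS]ctV; congr (_ * _)).
Qed.

Lemma shiftable_q : shiftable q /\ shiftable qV.
Proof.
have cq x y := @central_mulCA q x y (q_central x).
have cqV x y := @central_mulCA qV x y (qV_central x).
split=> -[[[[a b] c] d] e].
  exists (a, b, c, d, e + 1); rewrite /hmon zpowS //.
  by do 4!(rewrite [LHS]cq; congr (_ * _)).
  exists (a, b, c, d, e - 1); rewrite /hmon zpowP //.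
  by do 4!(rewrite [LHS]cqV; congr (_ * _)).
Qed.

Lemma hmon_central p x : GRing.comm (hmon p) x.
Proof.
case: p => -[[[a b] c] d] e; apply: commr_sym; rewrite /hmon.
by do 4?[apply: commrM]; apply: comm_zpow; apply: commr_sym;
  [exact: t_central | exact: tV_central | exact: t_central | exact: tV_central
  |exact: t_central | exact: tV_central | exact: t_central | exact: tV_central
  |exact: q_central | exact: qV_central].
Qed.

Variables (F : comNzRingType) (iota : {rmorphism F -> H}).
Hypothesis iota_central : forall c x, GRing.comm (iota c) x.

Definition hindex := (int * int * int * int * int * sword)%type.

Definition hword (s : seq letter) : H := \prod_(x <- s) hk x.

Definition hbasis (j : hindex) : H := hmon j.1 * hword (sword_seq j.2).

(** A formal combination is a list in which an index may recur; [group_terms] collects the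
    coefficients when uniqueness matters. *)
Definition hspan (x : H) :=
  exists l : seq (F * hindex), x = \sum_(u <- l) iota u.1 * hbasis u.2.

Lemma hspan0 : hspan 0.
Proof. by exists [::]; rewrite big_nil. Qed.

Lemma hspanD x y : hspan x -> hspan y -> hspan (x + y).
Proof. by move=> [l ->] [l' ->]; exists (l ++ l'); rewrite big_cat. Qed.

Lemma hspan_iota c x : hspan x -> hspan (iota c * x).
Proof.
move=> [l ->]; exists [seq (c * u.1, u.2) | u <- l].
by rewrite big_map mulr_sumr; apply: eq_bigr => u _; rewrite rmorphM mulrA.
Qed.

Lemma hspanN x : hspan x -> hspan (- x).
Proof. by move/(hspan_iota (-1)); rewrite rmorphN1 mulN1r. Qed.

Lemma hspanB x y : hspan x -> hspan y -> hspan (x - y).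
Proof. by move=> hx hy; apply: hspanD => //; apply: hspanN. Qed.

Lemma hspan_basis j : hspan (hbasis j).
Proof. by exists [:: (1, j)]; rewrite big_seq1 rmorph1 mul1r. Qed.

Lemma hspan_lift (g : H) x : (forall j, hspan (g * hbasis j)) -> hspan x -> hspan (g * x).
Proof.
move=> gP [l ->]; rewrite mulr_sumr; elim/big_rec: _ => [|u y _ hy].
  exact: hspan0.
apply: hspanD => //; rewrite mulrA -(iota_central _ g) -mulrA.
exact: hspan_iota.
Qed.

Lemma hspan_shift z x : shiftable z -> hspan x -> hspan (z * x).
Proof.
move=> zP; apply: hspan_lift => -[p s].
have [p' E] := zP p; rewrite /hbasis /= mulrA E.
exact: (hspan_basis (p', s)).
Qed.

Lemma hspan_q x : hspan x -> hspan (q * x).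
Proof. exact: hspan_shift (shiftable_q.1). Qed.

Lemma hspan_qV x : hspan x -> hspan (qV * x).
Proof. exact: hspan_shift (shiftable_q.2). Qed.

Lemma hspan_hT i x : hspan x -> hspan (hT i * x).
Proof.
by move=> hx; rewrite mulrDl; apply: hspanD; apply: hspan_shift => //;
  have [] := shiftable_t i.
Qed.

Lemma hword_cat u v : hword (u ++ v) = hword u * hword v.
Proof. by rewrite /hword big_cat. Qed.

Lemma hword_cons x u : hword (x :: u) = hk x * hword u.
Proof. by rewrite /hword big_cons. Qed.

Section Low.
Variables (u v : seq letter) (L : nat).
Hypothesis hlow : forall s, (size s < L)%N -> hspan (hword s).

(** Rewriting takes place between fixed words [u] and [v]. The bound [L] is to be the length of the
    whole word, all shorter words being known to lie in the span. *)
Definition low (y : H) := hspan (hword u * y * hword v).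

Lemma lowD y z : low y -> low z -> low (y + z).
Proof. by rewrite /low mulrDr mulrDl; apply: hspanD. Qed.

Lemma lowN y : low y -> low (- y).
Proof. by rewrite /low mulrN mulNr; apply: hspanN. Qed.

Lemma low_central z y : (forall x, GRing.comm z x) -> (forall x, hspan x -> hspan (z * x)) ->
  low y -> low (z * y).
Proof.
move=> zc zs; rewrite /low mulrA -(zc (hword u)) -!mulrA => h.
exact: zs.
Qed.

Lemma low_hT i y : low y -> low (hT i * y).
Proof. by apply: low_central; [apply: hT_central | apply: hspan_hT]. Qed.

Lemma low_q y : low y -> low (q * y).
Proof. by apply: low_central; [apply: q_central | apply: hspan_q]. Qed.

Lemma low_qV y : low y -> low (qV * y).
Proof. by apply: low_central; [apply: qV_central | apply: hspan_qV]. Qed.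

Lemma low_word w : (size (u ++ w ++ v) < L)%N -> low (hword w).
Proof. by rewrite /low -!hword_cat -catA; apply: hlow. Qed.

Lemma low_rest b : (size u + size v + 2 < L)%N -> low (hexagon_rest b).
Proof.
move=> ltL.
have W w : (size w <= 2)%N -> low (hword w).
  by move=> ?; apply: low_word; rewrite !size_cat; lia.
have W0 : low 1 by have := W [::] isT; rewrite /hword big_nil.
have W1 x : low (hk x) by have := W [:: x] isT; rewrite /hword big_seq1.
have W2 x y : low (hk x * hk y).
  by have := W [:: x; y] isT; rewrite /hword big_cons big_seq1.
rewrite /hexagon_rest.
by do ?[exact: W0 | exact: W1 | exact: W2 | apply: lowD | apply: lowN | apply: low_hT
  | apply: low_q].
Qed.

(** The swap can be used in both directions because q is invertible. *)
Lemma low_swap b : (size u + size v + 2 < L)%N ->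
  low (hword [:: pv b; b; nx b]) <-> low (hword [:: nx b; b; pv b]).
Proof.
move=> ltL; have hr := low_rest b ltL.
have E x y z : hword [:: x; y; z] = hk x * hk y * hk z.
  by rewrite /hword !big_cons big_nil mulr1 mulrA.
rewrite !E; split=> h; first by rewrite hk_swap; apply: lowD => //; do 2!apply: low_q.
have -> : hk (pv b) * hk b * hk (nx b) =
    qV * (qV * (hk (nx b) * hk b * hk (pv b) - hexagon_rest b)).
  by rewrite hk_swap addrK [qV * (q * _)]mulrA qV_q mul1r mulrA qV_q mul1r.
by do 2!apply: low_qV; apply: lowD => //; apply: lowN.
Qed.

Lemma low_sq x : (size u + size v + 1 < L)%N -> low (hword [:: x; x]).
Proof.
move=> ltL; have -> : hword [:: x; x] = hT (ltr_ord x) * hword [:: x] - hword [::].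
  by rewrite /hword !big_cons big_nil !mulr1 K_sq.
apply: lowD; first apply: low_hT; last apply: lowN.
  by apply: low_word; rewrite !size_cat /=; lia.
by apply: low_word; rewrite !size_cat /=; lia.
Qed.

End Low.

Lemma hspan_word s : hspan (hword s).
Proof.
have [n] := ubnP (size s); elim: n s => // n IHn s /ltnSE le_sn.
have hlow w : (size w < size s)%N -> hspan (hword w).
  by move=> lt_ws; apply: IHn; apply: leq_trans le_sn.
have sizeE (x y z : letter) u v : size (u ++ [:: x, y, z & v]) = (size u + size v + 3)%N.
  by rewrite size_cat /=; lia.
have hwE (x y z : letter) u v :
    hword (u ++ [:: x, y, z & v]) = hword u * hword [:: x; y; z] * hword v.
  by rewrite -!hword_cat -catA.
(* At fixed length, induct on the resolution: sorted words are basis elements, squares reduce to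
   shorter words, and a swap keeps the length and costs only shorter words. *)
elim: (resolves_all s) hlow => {s le_sn} [s|u x v|u b v _ IH|u b v _ IH] hlow.
- rewrite -[hword _]mul1r -hmon0; exact: (hspan_basis (_, s)).
- have -> : u ++ [:: x, x & v] = u ++ [:: x; x] ++ v by [].
  rewrite catA !hword_cat.
  by apply: (low_sq hlow); rewrite size_cat /=; lia.
- move: hlow IH; rewrite !sizeE => hlow /(_ hlow).
  rewrite !hwE.
  by apply: (low_swap hlow b _).1; lia.
- move: hlow IH; rewrite !sizeE => hlow /(_ hlow).
  rewrite !hwE.
  by apply: (low_swap hlow b _).2; lia.
Qed.

Lemma hspan_hmon p x : hspan x -> hspan (hmon p * x).
Proof.
move=> hx; case: p => -[[[a b] c] d] e; rewrite /hmon -!mulrA.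
have Z (z zV : H) n y : (forall x, hspan x -> hspan (z * x)) ->
    (forall x, hspan x -> hspan (zV * x)) -> hspan y -> hspan (zpow z zV n * y).
  move=> hz hzV hy; case: n => n /=.
    by elim: n => [|n IHn]; rewrite ?mul1r // exprS -mulrA; apply: hz.
  by elim: n => [|n IHn]; [rewrite expr1 | rewrite exprS -mulrA]; apply: hzV.
have Zt i n y : hspan y -> hspan (zpow (t i) (tV i) n * y).
  by apply: Z => ?; apply: hspan_shift; have [] := shiftable_t i.
by do 4!apply: (Zt _); apply: Z => // y; [apply: hspan_q | apply: hspan_qV].
Qed.

Lemma hspan_hk x y : hspan y -> hspan (hk x * y).
Proof.
apply: hspan_lift => -[p s]; rewrite /hbasis mulrA -(hmon_central _ (hk x)) -mulrA.
by apply: hspan_hmon; rewrite -hword_cons; apply: hspan_word.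
Qed.

(** K_4 is eliminated by [K3E], so words in the first three generators suffice. *)
Lemma hspan_K i y : hspan y -> hspan (K i * y).
Proof.
move=> hy; elim/ord4_ind: i => [x|]; first exact: hspan_hk.
rewrite K3E mulrBl -!mulrA; apply: hspanB; first exact: hspan_hT.
by apply: hspan_q; do 3!apply: hspan_hk.
Qed.

Lemma hspan1 : hspan 1.
Proof. by have := hspan_word [::]; rewrite /hword big_nil. Qed.

Lemma hspan_generators : [/\ hspan 1, forall i y, hspan y -> hspan (K i * y),
  forall i y, hspan y -> hspan (t i * y) /\ hspan (tV i * y)
  & forall y, hspan y -> hspan (q * y) /\ hspan (qV * y)].
Proof.
split; [exact: hspan1 | exact: hspan_K | | by split; [apply: hspan_q | apply: hspan_qV]].
by move=> i y hy; have [] := shiftable_t i; split; apply: hspan_shift.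
Qed.

End HeckeAlgebra.

(** * Two-by-two matrices over noncommutative rings *)

Section TwoByTwo.
Variable A : pzRingType.
Implicit Types a b c d : A.

Definition mx22 a b c d : 'M[A]_2 :=
  \matrix_(i < 2, j < 2)
    if i == ord0 then (if j == ord0 then a else b)
    else (if j == ord0 then c else d).

Lemma I2P (P : 'I_2 -> Prop) : P ord0 -> P ord_max -> forall i, P i.
Proof.
move=> P0 P1 i; case: (eqVneq i ord0) => [->//|i0].
suff -> : i = ord_max by [].
by apply/val_inj; case: i i0 => [[|[|]]].
Qed.

Lemma mx22P (M N : 'M[A]_2) :
  M ord0 ord0 = N ord0 ord0 -> M ord0 ord_max = N ord0 ord_max ->
  M ord_max ord0 = N ord_max ord0 -> M ord_max ord_max = N ord_max ord_max -> M = N.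
Proof. by move=> ????; apply/matrixP; elim/I2P; elim/I2P. Qed.

Lemma mx22M a b c d a' b' c' d' :
  mx22 a b c d *m mx22 a' b' c' d' =
  mx22 (a * a' + b * c') (a * b' + b * d') (c * a' + d * c') (c * b' + d * d').
Proof. by apply: mx22P; rewrite !mxE big_ord_recl big_ord1 !mxE. Qed.

Lemma mx22B a b c d a' b' c' d' :
  mx22 a b c d - mx22 a' b' c' d' = mx22 (a - a') (b - b') (c - c') (d - d').
Proof. by apply: mx22P; rewrite !mxE. Qed.

Lemma mx22_scalar a : a%:M = mx22 a 0 0 a.
Proof. by apply: mx22P; rewrite !mxE. Qed.

Lemma mx22_0 : 0 = mx22 0 0 0 0.
Proof. by apply: mx22P; rewrite !mxE. Qed.

(** The Leibniz formula multiplies entries in the order of the rows, which fixes the order of the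
    factors over a noncommutative ring. *)
Lemma det_mx22 a b c d : \det (mx22 a b c d) = a * d - b * c.
Proof.
pose s := tperm (ord0 : 'I_2) ord_max.
have S2 : [set: 'S_2] = [set 1%g; s].
  apply/eqP; rewrite eq_sym eqEcard subsetT cardsT card_Sn cards2.
  by rewrite -[1%g](tperm1 ord0) eq_sym /s; case: eqP => // /perm.permP/(_ ord0); rewrite !permE.
rewrite /determinant (eq_bigl (mem [set 1%g; s])) => [|u]; last by rewrite /= -S2 inE.
rewrite big_setU1 ?big_set1 /=; last first.
  by rewrite inE; apply/eqP => /perm.permP/(_ ord0); rewrite !permE.
rewrite odd_perm1 odd_tperm expr0 expr1 mul1r mulN1r !big_ord_recl !big_ord0 !mulr1.
by rewrite !perm1 !permE !mxE.
Qed.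

End TwoByTwo.

(* Cayley-Hamilton for trace [x + y] and determinant 1; the entries need only *)
(* commute as far as the four hypotheses tell.                                *)
Lemma quadratic22 (A : pzRingType) (x y a b c d : A) :
  (forall u, GRing.comm x u) -> (forall u, GRing.comm y u) -> x * y = 1 ->
  a + d = x + y -> a * d = 1 + b * c -> a * d = 1 + c * b ->
  a * b = b * a -> c * a = a * c ->
  (mx22 a b c d - x%:M) *m (mx22 a b c d - y%:M) = 0.
Proof.
move=> xC yC xy tr adbc adcb ab ca.
have dx : d - x = y - a.
  by apply/eqP; rewrite subr_eq addrAC eq_sym subr_eq [d + a]addrC tr addrC.
have dy : d - y = x - a.
  by apply/eqP; rewrite subr_eq addrAC eq_sym subr_eq [d + a]addrC tr.
have ax u : u * x = x * u by rewrite xC.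
have ay u : u * y = y * u by rewrite yC.
have dE : d = x + y - a by rewrite -tr addrAC subrr add0r.
rewrite !mx22_scalar !mx22B !subr0 mx22M dx dy mx22_0; congr mx22.
- have -> : b * c = a * d - 1 by rewrite adbc addrC addKr.
  rewrite dE mulrBl !mulrBr mulrDr ax ay.
  apply/eqP; rewrite addr_eq0 !(opprB, opprD, opprK) !addrA.
  by rewrite xy [X in X == _](ACl (3*1*4*2)).
- by rewrite mulrBl mulrBr ab ax addrA subrK subrr.
- by rewrite mulrBl mulrBr ca ay addrA subrK subrr.
- have -> : c * b = a * d - 1 by rewrite adcb addrC addKr.
  rewrite dE !mulrBl !mulrBr mulrDr (ax a) (ay a) (ax y) xy.
  apply/eqP; rewrite addrC addr_eq0 !(opprB, opprD, opprK) !addrA.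
  by rewrite [X in X == _](ACl (1*3*4*2)).
Qed.

Section CentralTrace.
Variables (A : pzRingType) (x y m n : A).
Hypothesis xC : forall u, GRing.comm x u.
Hypothesis yC : forall u, GRing.comm y u.
Hypothesis xy : x * y = 1.
Hypothesis mn : m * n = 1.
Hypothesis nm : n * m = 1.

Let trC u : GRing.comm u (x + y).
Proof. by apply: commrD; apply: commr_sym. Qed.

Let comm_nm : GRing.comm n m. Proof. by rewrite /GRing.comm mn nm. Qed.

(** The shape of [Bmx], with [m] for [be * b] and [n] for its inverse. The entries lie in a
    commutative subring, so [quadratic22] applies; [quadratic_upper] plays the same part for
    [Gmx]. *)
Lemma quadratic_lower :
  (mx22 (x + y + n) (x + y + n + m) (- n) (- n) - x%:M) *m
  (mx22 (x + y + n) (x + y + n + m) (- n) (- n) - y%:M) = 0.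
Proof.
have cn : GRing.comm n (x + y + n) by apply: commrD.
apply: quadratic22 => //.
- by rewrite addrK.
- by rewrite (mulrDl _ m) [m * - n]mulrN mn [RHS]addrC subrK.
- by rewrite [- n * _]mulrDr [- n * m]mulNr nm [RHS]addrC subrK mulrN mulNr cn.
- apply: commrD; first by [].
  by apply: commr_sym; apply: commrD => //; apply: commr_sym.
- exact: (commr_sym (commrN (commr_sym cn))).
Qed.

Lemma det_lower : \det (mx22 (x + y + n) (x + y + n + m) (- n) (- n)) = 1.
Proof. by rewrite det_mx22 (mulrDl _ m) opprD addrA subrr add0r mulrN opprK mn. Qed.

Lemma quadratic_upper :
  (mx22 (x + y + m) m (- (x + y + n + m)) (- m) - x%:M) *m
  (mx22 (x + y + m) m (- (x + y + n + m)) (- m) - y%:M) = 0.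
Proof.
have cm : GRing.comm m (x + y + m) by apply: commrD.
have E : x + y + n + m = x + y + m + n by rewrite addrAC.
apply: quadratic22 => //.
- by rewrite addrK.
- by rewrite E !mulrN mulrDr mn opprD addrCA subrr addr0 cm.
- by rewrite E mulrN mulNr [X in _ = 1 - X]mulrDl nm opprD addrCA subrr addr0.
- rewrite E; apply: commr_sym; apply: commrN; apply: commrD; first by [].
  by apply: commr_sym; apply: commrD.
Qed.

Lemma det_upper : \det (mx22 (x + y + m) m (- (x + y + n + m)) (- m)) = 1.
Proof.
rewrite det_mx22 (addrAC _ n) !mulrN mulrDr mn opprK addrA.
have -> : m * (x + y + m) = (x + y + m) * m by apply: commrD.
by rewrite addNr add0r.
Qed.

End CentralTrace.

(** * The matrix relations in any ring with the commutation rules of the torus *)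

Section Relations.
Variable A : pzRingType.
Variables al alV be beV ga gaV q qV o oV b bV g gV : A.
Hypothesis alC : forall x, GRing.comm al x.
Hypothesis alVC : forall x, GRing.comm alV x.
Hypothesis beC : forall x, GRing.comm be x.
Hypothesis beVC : forall x, GRing.comm beV x.
Hypothesis gaC : forall x, GRing.comm ga x.
Hypothesis gaVC : forall x, GRing.comm gaV x.
Hypothesis qC : forall x, GRing.comm q x.
Hypothesis qVC : forall x, GRing.comm qV x.
Hypothesis al_alV : al * alV = 1.
Hypothesis be_beV : be * beV = 1.
Hypothesis ga_gaV : ga * gaV = 1.
Hypothesis q_qV : q * qV = 1.
Hypothesis o_oV : o * oV = 1.
Hypothesis oV_o : oV * o = 1.
Hypothesis b_bV : b * bV = 1.
Hypothesis bV_b : bV * b = 1.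
Hypothesis g_gV : g * gV = 1.
Hypothesis gV_g : gV * g = 1.
Hypothesis go : g * o = qV * (qV * (o * g)).
Hypothesis bg : b * g = qV * (qV * (g * b)).
Hypothesis ob : o * b = qV * (qV * (b * o)).

Definition Omx := mx22 0 (alV * oV) (- (al * o)) (al + alV).
Definition Bmx :=
  mx22 (be + beV + beV * bV) (be + beV + beV * bV + be * b)
       (- (beV * bV)) (- (beV * bV)).
Definition Gmx :=
  mx22 (ga + gaV + ga * g) (ga * g)
       (- ga - gaV - gaV * gV - ga * g) (- (ga * g)).
Definition t4 := q * al * be * ga * o * b * g.
Definition t4V := q * alV * beV * gaV * oV * bV * gV.
Definition z4 :=
    (al + alV) * beV * gaV * bV * gV
  + (be + beV) * gaV * al * o * gV
  + (ga + gaV) * al * be * o * b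
  + al * be * ga * o * b * g
  + al * be * gaV * o * b * gV
  + al * beV * gaV * o * bV * gV.
Definition Pmx := mx22 t4 0 (- (q * z4)) t4V.

Lemma det_Omx : \det Omx = 1.
Proof.
rewrite det_mx22 mul0r mulrN opprK add0r -mulrA (mulrA oV) -(alC oV) -mulrA oV_o.
by rewrite mulr1 alVC al_alV.
Qed.


Lemma Omx_quadratic : (Omx - al%:M) *m (Omx - alV%:M) = 0.
Proof.
apply: quadratic22 => //; rewrite ?add0r ?mul0r ?mulr0 //.
  by rewrite mulrN -mulrA (mulrA oV) -(alC oV) -mulrA oV_o mulr1 alVC al_alV subrr.
by rewrite mulNr -mulrA (mulrA o) -(alVC o) -mulrA o_oV mulr1 al_alV subrr.
Qed.

Lemma central_cancel (x y u v : A) : (forall w, GRing.comm y w) ->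
  x * y = 1 -> u * v = 1 -> x * u * (y * v) = 1.
Proof. by move=> yC xy uv; rewrite -mulrA (mulrA u) -(yC u) -mulrA uv mulr1. Qed.

Let beV_be : beV * be = 1. Proof. by rewrite beVC. Qed.
Let gaV_ga : gaV * ga = 1. Proof. by rewrite gaVC. Qed.

Let mnB : be * b * (beV * bV) = 1. Proof. exact: central_cancel. Qed.
Let nmB : beV * bV * (be * b) = 1. Proof. exact: central_cancel. Qed.
Let mnG : ga * g * (gaV * gV) = 1. Proof. exact: central_cancel. Qed.
Let nmG : gaV * gV * (ga * g) = 1. Proof. exact: central_cancel. Qed.

Lemma Bmx_quadratic : (Bmx - be%:M) *m (Bmx - beV%:M) = 0.
Proof. exact: quadratic_lower. Qed.

Lemma det_Bmx : \det Bmx = 1.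
Proof. exact: det_lower. Qed.

Lemma GmxE : Gmx = mx22 (ga + gaV + ga * g) (ga * g)
  (- (ga + gaV + gaV * gV + ga * g)) (- (ga * g)).
Proof. by rewrite /Gmx !opprD. Qed.

Lemma Gmx_quadratic : (Gmx - ga%:M) *m (Gmx - gaV%:M) = 0.
Proof. by rewrite GmxE; apply: quadratic_upper. Qed.

Lemma det_Gmx : \det Gmx = 1.
Proof. by rewrite GmxE; apply: det_upper. Qed.

Lemma t4E : t4 = q * (al * (be * (ga * (o * (b * g))))).
Proof. by rewrite /t4 -!mulrA. Qed.

Lemma t4VE : t4V = q * (alV * (beV * (gaV * (oV * (bV * gV))))).
Proof. by rewrite /t4V -!mulrA. Qed.

Lemma pull (z u v : A) : (forall w, GRing.comm z w) -> u * (z * v) = z * (u * v).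
Proof. by move=> zC; rewrite mulrA -zC mulrA. Qed.

Let s := qV * qV.
Let r := q * q.
Let sC u : GRing.comm s u. Proof. by apply/commr_sym/commrM; apply/commr_sym. Qed.
Let rC u : GRing.comm r u. Proof. by apply/commr_sym/commrM; apply/commr_sym. Qed.
Let rs : r * s = 1. Proof. by rewrite /r /s -mulrA (mulrA q qV) q_qV mul1r q_qV. Qed.
Let sr : s * r = 1. Proof. by rewrite sC rs. Qed.

Lemma qcomm_inv (x xV y yV : A) :
  x * xV = 1 -> xV * x = 1 -> y * yV = 1 -> yV * y = 1 ->
  x * y = s * (y * x) -> x * yV = r * (yV * x) /\ xV * y = r * (y * xV).
Proof.
move=> xxV xVx yyV yVy E.
have E' : y * x = r * (x * y) by rewrite E mulrA rs mul1r.
split.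
  by rewrite -[x * yV]mul1r -yVy -mulrA (mulrA y) E' -mulrA (pull _ _ rC) -!mulrA yyV mulr1.
by rewrite -[y in LHS]mulr1 -xxV (mulrA y) E' -mulrA (pull _ _ rC) -(mulrA x y) (mulrA xV x) xVx mul1r.
Qed.

(** The inverses come in the same order as the variables, and reordering them costs exactly q^{-2}.
    The factor q in each of [t4] and [t4V] compensates this. *)
Lemma obg_inv : o * (b * (g * (oV * (bV * gV)))) = s.
Proof.
have [g_oV _] : g * oV = r * (oV * g) /\ gV * o = r * (o * gV).
  by apply: qcomm_inv; rewrite // go /s -mulrA.
have [_ oVb] : o * bV = r * (bV * o) /\ oV * b = r * (b * oV).
  by apply: qcomm_inv; rewrite // ob /s -mulrA.
have b_oV : b * oV = s * (oV * b) by rewrite oVb mulrA sr mul1r.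
rewrite (mulrA g) g_oV -!(mulrA r) (pull _ _ rC) -!(mulrA oV) (mulrA b oV) b_oV -!(mulrA s).
rewrite (mulrA r) rs mul1r -(mulrA oV) (mulrA o) o_oV mul1r (mulrA b g).
by rewrite bg (mulrA qV qV) -/s -!mulrA (mulrA b bV) b_bV mul1r g_gV mulr1.
Qed.

Lemma inv_obg : oV * (bV * (gV * (o * (b * g)))) = s.
Proof.
have [g_oV gV_o] : g * oV = r * (oV * g) /\ gV * o = r * (o * gV).
  by apply: qcomm_inv; rewrite // go /s -mulrA.
have [obV oVb] : o * bV = r * (bV * o) /\ oV * b = r * (b * oV).
  by apply: qcomm_inv; rewrite // ob /s -mulrA.
have bV_o : bV * o = s * (o * bV) by rewrite obV mulrA sr mul1r.
rewrite (mulrA gV) gV_o -!(mulrA r) (pull _ _ rC) -!(mulrA o) (mulrA bV o) bV_o -!(mulrA s).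
rewrite (mulrA r) rs mul1r -(mulrA o) (mulrA oV) oV_o mul1r.
by rewrite bg (mulrA qV qV) -/s !(pull _ _ sC) (mulrA gV) gV_g mul1r bV_b mulr1.
Qed.

Lemma central_ACA (x u y v : A) : (forall w, GRing.comm y w) ->
  x * u * (y * v) = x * y * (u * v).
Proof. by move=> yC; rewrite -!mulrA (pull _ _ yC). Qed.

Let c := q * (al * (be * ga)).
Let cV := q * (alV * (beV * gaV)).
Let cVC u : GRing.comm cV u.
Proof. by apply: commr_sym; do ?apply: commrM; apply: commr_sym. Qed.
Let ccV : c * cV = r.
Proof.
rewrite /c /cV (central_ACA _ _ _ qC) (central_ACA _ _ _ alVC) (central_ACA _ _ _ beVC).
by rewrite al_alV be_beV ga_gaV !mulr1.
Qed.

Lemma t4_t4V : t4 * t4V = 1.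
Proof.
have -> : t4 = c * (o * (b * g)) by rewrite t4E /c -!mulrA.
have -> : t4V = cV * (oV * (bV * gV)) by rewrite t4VE /cV -!mulrA.
by rewrite (central_ACA _ _ _ cVC) ccV -(mulrA o) -(mulrA b) obg_inv rs.
Qed.

Lemma t4V_t4 : t4V * t4 = 1.
Proof.
have cC u : GRing.comm c u.
  by apply: commr_sym; do ?apply: commrM; apply: commr_sym.
have -> : t4 = c * (o * (b * g)) by rewrite t4E /c -!mulrA.
have -> : t4V = cV * (oV * (bV * gV)) by rewrite t4VE /cV -!mulrA.
by rewrite (central_ACA _ _ _ cC) cVC ccV -(mulrA oV) -(mulrA bV) inv_obg rs.
Qed.

Hypothesis t4C : forall x, GRing.comm t4 x.

Let t4VC x : GRing.comm t4V x.
Proof. exact: comm_inv t4_t4V t4V_t4 (t4C x). Qed.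

Lemma det_Pmx : \det Pmx = 1.
Proof. by rewrite det_mx22 t4_t4V mul0r subr0. Qed.

Lemma Pmx_quadratic : (Pmx - t4%:M) *m (Pmx - t4V%:M) = 0.
Proof.
apply: quadratic22 => //; rewrite ?mul0r ?mulr0 ?addr0 ?t4_t4V //.
by rewrite t4C.
Qed.

Let n := alV * oV * (beV * bV).
Let m := al * o * (be * b).
Let u := - (al * o) * (be + beV + beV * bV) - (al + alV) * (beV * bV).

Lemma OBmxE : Omx *m Bmx = mx22 (- n) (- n) u (u - m).
Proof.
rewrite mx22M !mul0r !add0r !mulrN; congr mx22 => //.
by rewrite (mulrDr _ _ (be * b)) addrAC -/u mulNr.
Qed.

(** Most of the terms with [u] cancel, leaving nine monomials, which are those of [z4] up to moving
    central factors. *)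
Lemma OBG21 :
  u * (ga + gaV + ga * g) + (u - m) * - (ga + gaV + gaV * gV + ga * g) = z4.
Proof.
have SC w : GRing.comm (be + beV) w by apply: commr_sym; apply: commrD; apply: commr_sym.
have GC w : GRing.comm (ga + gaV) w by apply: commr_sym; apply: commrD; apply: commr_sym.
have -> : u * (ga + gaV + ga * g) + (u - m) * - (ga + gaV + gaV * gV + ga * g) =
    - u * (gaV * gV) + m * (ga + gaV + gaV * gV + ga * g).
  move: u m => u' m'; rewrite mulrN mulrBl opprB addrCA addrC; congr (_ + _).
  by rewrite -mulrBr (addrAC _ (gaV * gV)) opprD addrA subrr add0r mulrN mulNr.
rewrite /u opprB mulNr opprK [(al + alV) * _ + _]addrC !mulrDl !mulrDr !mulrDl -!addrA.
(* The permutation lists the nine monomials in the order of [z4]; the identities [mv1] to [mv4] then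
   move central factors within each. *)
rewrite /z4 !mulrDl !addrA [LHS](ACl (4*5*1*2*6*7*9*8*3)) /=.
have mv1 (x y z x1 x2 : A) : (forall w, GRing.comm z w) ->
  x * (y * x1) * (z * x2) = x * y * z * x1 * x2.
  by move=> zC; rewrite -!mulrA (pull x1 _ zC).
have mv2 (x y z x1 x2 : A) : (forall w, GRing.comm y w) -> (forall w, GRing.comm z w) ->
  x * x1 * y * (z * x2) = y * z * x * x1 * x2.
  by move=> yC zC; rewrite -!mulrA (pull x1 _ yC) (pull x _ yC) (pull x1 _ zC) (pull x _ zC).
have mv3 (x y z x1 x2 : A) : (forall w, GRing.comm y w) -> (forall w, GRing.comm z w) ->
  x * x1 * (y * x2) * z = z * x * y * x1 * x2.
  by move=> yC zC; rewrite -zC -!mulrA (pull x1 _ yC).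
have mv4 (x y z x1 x2 x3 : A) : (forall w, GRing.comm y w) -> (forall w, GRing.comm z w) ->
  x * x1 * (y * x2) * (z * x3) = x * y * z * x1 * x2 * x3.
  by move=> yC zC; rewrite -!mulrA (pull x1 _ yC) (pull x2 _ zC) (pull x1 _ zC).
by rewrite /m; do ?[congr (_ + _)];
  first [exact: mv1 | exact: mv2 | exact: mv3 | exact: mv4].
Qed.

Lemma OBGmxE :
  Omx *m Bmx *m Gmx = mx22 (n * (gaV * gV)) 0 z4 (m * (ga * g)).
Proof.
rewrite OBmxE GmxE mx22M; congr mx22.
- rewrite !mulNr mulrN opprK addrC -mulrBr (addrAC _ (gaV * gV)).
  by rewrite [_ + gaV * gV - _]addrAC subrr add0r.
- by rewrite mulrN !mulNr opprK addNr.
- exact: OBG21.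
- by move: u m => u' m'; rewrite mulrN mulrBl opprB addrCA subrr addr0.
Qed.

(** Up to q, the diagonal entries of the triangular product are [t4V] and [t4]; the off-diagonal
    entry cancels because [t4] is central. *)
Lemma OBGPmx : Omx *m Bmx *m Gmx *m Pmx = qV%:M.
Proof.
have qVq : qV * q = 1 by rewrite qVC.
have tE : t4 = q * (m * (ga * g)).
  rewrite t4E /m -!mulrA (pull o _ beC) (pull b _ gaC) (pull o _ gaC) //.
have tVE : t4V = q * (n * (gaV * gV)).
  rewrite t4VE /n -!mulrA (pull oV _ beVC) (pull bV _ gaVC) (pull oV _ gaVC) //.
have div x : q * x = 1 -> x = qV by move=> qx; rewrite -[x]mul1r -qVq -mulrA qx mulr1.
rewrite OBGmxE mx22M mx22_scalar !mul0r !mulr0 !add0r !addr0; congr mx22.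
- by apply: div; rewrite mulrA -tVE t4V_t4.
- by rewrite mulrN -t4C tE (pull _ _ qC) -mulrA subrr.
- by apply: div; rewrite mulrA -tE t4_t4V.
Qed.

Variables (R : realType) (iota : {rmorphism R[i] -> A}).
Hypothesis iotaC : forall k x, GRing.comm (iota k) x.

(** The default value of [nth] is never reached, as indices are below 4. *)
Definition Kmx (i : 'I_4) : 'M[A]_2 := nth 0 [:: Omx; Bmx; Gmx; Pmx] i.
Definition tpar (i : 'I_4) : A := nth 0 [:: al; be; ga; t4] i.
Definition tparV (i : 'I_4) : A := nth 0 [:: alV; beV; gaV; t4V] i.

Definition hgen_image (h : hgen) : 'M[A]_2 :=
  match h with
  | gK i => Kmx i
  | gT i => (tpar i)%:M
  | gTV i => (tparV i)%:M
  | gQh => q%:M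
  | gQhV => qV%:M
  end.

Lemma scalar_central22 (z : A) (M : 'M[A]_2) :
  (forall x, GRing.comm z x) -> GRing.comm z%:M M.
Proof.
have l2 : lift ord0 ord0 = ord_max :> 'I_2 by apply/val_inj.
move=> zC; apply: mx22P; rewrite !mxE !big_ord_recl !big_ord0 !mxE /= l2;
by rewrite ?(mulr0, mul0r, add0r, addr0, mulr1n, zC).
Qed.

Lemma ord4_case (P : 'I_4 -> Prop) :
  P (inord 0) -> P (inord 1) -> P (inord 2) -> P (inord 3) -> forall i, P i.
Proof. by move=> p0 p1 p2 p3; apply: ord4_ind => // -[]. Qed.

Lemma tpar_central i x : GRing.comm (tpar i) x.
Proof. by elim/ord4_case: i; rewrite /tpar inordK //=. Qed.

Lemma tpar_tparV i : tpar i * tparV i = 1 /\ tparV i * tpar i = 1.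
Proof.
elim/ord4_case: i; rewrite /tpar /tparV !inordK //=;
by split; rewrite // ?(alVC, beVC, gaVC, t4_t4V, t4V_t4).
Qed.

Lemma Kmx_quadratic i : (Kmx i - (tpar i)%:M) *m (Kmx i - (tparV i)%:M) = 0.
Proof.
elim/ord4_case: i; rewrite /Kmx /tpar /tparV !inordK //=.
- exact: Omx_quadratic.
- exact: Bmx_quadratic.
- exact: Gmx_quadratic.
- exact: Pmx_quadratic.
Qed.

Lemma HD4_morphism : exists phi : {rmorphism HD4 R -> 'M[A]_2},
  (forall h, phi (presGen (@hrel R) h) = hgen_image h) /\
  (forall k x, phi (k *: x) = (iota k)%:M * phi x).
Proof.
have iC k h : (iota k)%:M * hgen_image h = hgen_image h * (iota k)%:M.
  by apply: scalar_central22 => x; apply: iotaC.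
pose ev := freeEval (scalar_mx \o iota) hgen_image.
have eM f h : ev (f * h) = ev f * ev h by exact: (freeEvalM (iota := scalar_mx \o iota) iC f h).
have eB f h : ev (f - h) = ev f - ev h by rewrite /ev freeEvalD freeEvalN.
have e1 : ev 1 = 1 by exact: freeEval1.
have e0 : ev 0 = 0 by exact: freeEval0.
have eg x : ev (freeGen R[i] x) = hgen_image x by exact: freeEval_gen.
have qVq : qV * q = 1 by rewrite qVC.
have relE f h : @hrel R f h -> ev f = ev h.
  case=> [i|i|||i x|x|i|].
  - by rewrite [RHS]e1 [LHS]eM !eg [LHS]/GRing.mul /= -scalar_mxM (tpar_tparV i).1.
  - by rewrite [RHS]e1 [LHS]eM !eg [LHS]/GRing.mul /= -scalar_mxM (tpar_tparV i).2.
  - by rewrite [RHS]e1 [LHS]eM !eg [LHS]/GRing.mul /= -scalar_mxM q_qV.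
  - by rewrite [RHS]e1 [LHS]eM !eg [LHS]/GRing.mul /= -scalar_mxM qVq.
  - rewrite [LHS]eM [RHS]eM !eg; apply: scalar_central22; exact: tpar_central.
  - rewrite [LHS]eM [RHS]eM !eg; exact: scalar_central22.
  - rewrite [RHS]e0 [LHS]eM [X in X * _]eB [X in _ * X]eB !eg; exact: Kmx_quadratic.
  - rewrite [LHS]eM [X in X * _]eM [X in X * _ * _]eM !eg.
    by rewrite /= /Kmx !inordK //=; apply: OBGPmx.
have [phi phiE phiZ] := presAlg_universal (iota := scalar_mx \o iota) iC relE.
by exists phi.
Qed.

Lemma D4_representation :
  [/\ \det Omx = 1, \det Bmx = 1, \det Gmx = 1 & \det Pmx = 1] /\
  [/\ (Omx - al%:M) *m (Omx - alV%:M) = 0, (Bmx - be%:M) *m (Bmx - beV%:M) = 0,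
      (Gmx - ga%:M) *m (Gmx - gaV%:M) = 0, (Pmx - t4%:M) *m (Pmx - t4V%:M) = 0
    & Omx *m Bmx *m Gmx *m Pmx = qV%:M] /\
  exists phi : {rmorphism HD4 R -> 'M[A]_2},
    (forall h, phi (presGen (@hrel R) h) = hgen_image h) /\
    (forall k x, phi (k *: x) = (iota k)%:M * phi x).
Proof.
split; [|split; last exact: HD4_morphism].
  by split; [exact: det_Omx | exact: det_Bmx | exact: det_Gmx | exact: det_Pmx].
split; [exact: Omx_quadratic | exact: Bmx_quadratic | exact: Gmx_quadratic
  | exact: Pmx_quadratic | exact: OBGPmx].
Qed.

End Relations.

(** * Defining relations read inside the presented algebra *)

Section PresentationRelations.
Variables (K : comNzRingType) (X : choiceType).
Variable rel : {malg K[{fmonom X}]} -> {malg K[{fmonom X}]} -> Prop.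
Local Notation v := (freeGen K).
Local Notation gen := (presGen rel).

Lemma presGen_mul1 x y : rel (v x * v y) 1 -> gen x * gen y = 1.
Proof.
move/presPi_eq => E; transitivity (presPi rel (v x * v y)); first by rewrite [RHS]rmorphM.
by rewrite E; apply: rmorph1.
Qed.

Lemma presGen_comm x y : rel (v x * v y) (v y * v x) -> GRing.comm (gen x) (gen y).
Proof.
move/presPi_eq => E; transitivity (presPi rel (v x * v y)); first by rewrite [RHS]rmorphM.
by rewrite E [LHS]rmorphM.
Qed.

Lemma presGen_qcomm x y z n : rel (v x * v y) (v z ^+ n * v y * v x) ->
  gen x * gen y = gen z ^+ n * (gen y * gen x).
Proof.
move/presPi_eq => E; transitivity (presPi rel (v x * v y)); first by rewrite [RHS]rmorphM.
rewrite E [LHS]rmorphM [X in X * _]rmorphM [X in X * _ * _]rmorphXn.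
by rewrite -[LHS]mulrA.
Qed.

Lemma presGen_Hecke x y z : rel ((v x - v y) * (v x - v z)) 0 ->
  (gen x - gen y) * (gen x - gen z) = 0.
Proof.
move/presPi_eq => E; transitivity (presPi rel ((v x - v y) * (v x - v z))).
  by rewrite [RHS]rmorphM [X in _ = X * _]rmorphB [X in _ = _ * X]rmorphB.
by rewrite E; apply: rmorph0.
Qed.

Lemma presGen_mul4 x y z w u : rel (v x * v y * v z * v w) (v u) ->
  gen x * gen y * gen z * gen w = gen u.
Proof.
move/presPi_eq => E; transitivity (presPi rel (v x * v y * v z * v w)); last by rewrite E.
by rewrite [RHS]rmorphM [X in _ = X * _]rmorphM [X in _ = X * _ * _]rmorphM.
Qed.

Lemma presGen_central x :
  (forall y, rel (v x * v y) (v y * v x)) -> forall u, GRing.comm (gen x) u.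
Proof. by move=> h; apply: presAlg_central => y; apply: presGen_comm. Qed.

(** A presented algebra is declared only as a ring and a module; this ring morphism carries its
    scalars. *)
Definition scalar_of (c : K) : presAlg rel := c *: (1 : presAlg rel).

Lemma scalar_ofE c u : scalar_of c * u = c *: u.
Proof. by rewrite -pres_scaleAl mul1r. Qed.

Fact scalar_of_zmod : {morph scalar_of : c d / c - d}.
Proof. by move=> c d; rewrite /scalar_of scalerBl. Qed.

Fact scalar_of_monoid : monoid_morphism scalar_of.
Proof.
by split=> [|c d]; rewrite ?/scalar_of ?scale1r // [in RHS]scalar_ofE scalerA.
Qed.

HB.instance Definition _ := GRing.isZmodMorphism.Build _ _ scalar_of scalar_of_zmod.
HB.instance Definition _ := GRing.isMonoidMorphism.Build _ _ scalar_of scalar_of_monoid.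

Lemma scalar_of_central c u : GRing.comm (scalar_of c) u.
Proof. by rewrite /GRing.comm scalar_ofE -pres_scaleAr mulr1. Qed.
End PresentationRelations.

(** * Central elements of the quantum torus, and the homomorphism into its matrices *)

Section QuantumPlaneCenter.
Variables (A : pzRingType) (s r x y z : A).
Hypothesis sC : forall u, GRing.comm s u.
Hypothesis rC : forall u, GRing.comm r u.
Hypothesis sr : s * r = 1.
Hypothesis rs : r * s = 1.
Hypothesis zx : z * x = s * (x * z).
Hypothesis yz : y * z = s * (z * y).
Hypothesis xy : x * y = s * (y * x).

Lemma qcomm_flip (s' r' a b : A) : r' * s' = 1 -> a * b = s' * (b * a) -> b * a = r' * (a * b).
Proof. by move=> rs' ->; rewrite mulrA rs' mul1r. Qed.

Lemma qcomm_sq (s' a b : A) : (forall u, GRing.comm s' u) -> a * b = s' * (b * a) ->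
  a ^+ 2 * b = s' ^+ 2 * (b * a ^+ 2).
Proof.
move=> s'C E; rewrite !expr2 -mulrA E (pull _ _ s'C) (mulrA a) E.
by rewrite -!mulrA.
Qed.

Lemma qcomm_sq2 (s' a b : A) : (forall u, GRing.comm s' u) -> a * b = s' * (b * a) ->
  a * b ^+ 2 = s' ^+ 2 * (b ^+ 2 * a).
Proof.
move=> s'C E; rewrite !expr2 mulrA E -mulrA -(mulrA b) E (pull _ _ s'C).
by rewrite -!mulrA.
Qed.

Lemma qcomm_prod3 (a b c X Y Z t : A) :
  (forall u, GRing.comm b u) -> (forall u, GRing.comm c u) -> c * (b * a) = 1 ->
  X * t = a * (t * X) -> Y * t = b * (t * Y) -> Z * t = c * (t * Z) ->
  GRing.comm (X * (Y * Z)) t.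
Proof.
move=> bC cC cba Xt Yt Zt; rewrite /GRing.comm -(mulrA X) -(mulrA Y) Zt.
rewrite (pull _ _ cC) (mulrA Y) Yt -(mulrA b) (pull X _ cC) (pull X _ bC).
rewrite -(mulrA t) (mulrA X t) Xt -(mulrA a) -(mulrA t).
by rewrite (mulrA b) (mulrA c) cba mul1r.
Qed.

(** Each variable commutes with the other two up to opposite powers of [s], so these powers cancel
    in a product with equal exponents. *)
Lemma square_prod_central : let w := x ^+ 2 * (y ^+ 2 * z ^+ 2) in
  [/\ GRing.comm w x, GRing.comm w y & GRing.comm w z].
Proof.
have cX (u : A) : (forall v, GRing.comm u v) -> forall v, GRing.comm (u ^+ 2) v.
  by move=> uC v; apply/commr_sym/commrX/commr_sym.
have s2r2 : s ^+ 2 * r ^+ 2 = 1.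
  by rewrite !expr2 mulrA -(mulrA s s r) sr mulr1 sr.
have r2s2 : r ^+ 2 * s ^+ 2 = 1 by rewrite cX.
have c1 u : GRing.comm (1 : A) u by apply/commr_sym/commr1.
have sq1 (u : A) : u ^+ 2 * u = 1 * (u * u ^+ 2) by rewrite mul1r -exprSr -exprS.
move=> w; split; rewrite /w {w}.
- apply: (qcomm_prod3 (cX _ rC) (cX _ sC) _ (sq1 x)); first by rewrite mulr1.
    exact: qcomm_sq rC (qcomm_flip rs xy).
  exact: qcomm_sq sC zx.
- apply: (qcomm_prod3 c1 (cX _ rC) _ (qcomm_sq sC xy) (sq1 y)); first by rewrite mul1r.
  exact: qcomm_sq rC (qcomm_flip rs yz).
- apply: (qcomm_prod3 (cX _ sC) c1 _ (qcomm_sq rC (qcomm_flip rs zx)) (qcomm_sq sC yz) (sq1 z)).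
  by rewrite mul1r.
Qed.

Lemma qcomm_squares a b : a * b = s * (b * a) ->
  a ^+ 2 * b ^+ 2 = s ^+ 4 * (b ^+ 2 * a ^+ 2).
Proof.
move=> E; have s2C u : GRing.comm (s ^+ 2) u by apply/commr_sym/commrX/commr_sym.
by rewrite (qcomm_sq2 s2C (qcomm_sq sC E)) -exprM.
Qed.
End QuantumPlaneCenter.

Section Torus.
Variable R : realType.
Local Notation X := (XQ2 R).
Local Notation xgen := (presGen (@xrel R)).
Local Notation Zh := (Zh R).
Local Notation ZhV := (ZhV R).

Definition q8 : X := xgen gQ8.
Definition q8V : X := xgen gQ8V.

Lemma Zh_ZhV a : Zh a * ZhV a = 1.
Proof. exact: presGen_mul1 (xrel_ZZV R a). Qed.

Lemma ZhV_Zh a : ZhV a * Zh a = 1.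
Proof. exact: presGen_mul1 (xrel_ZVZ R a). Qed.

Lemma q8_q8V : q8 * q8V = 1.
Proof. exact: presGen_mul1 (xrel_QQV R). Qed.

Lemma q8V_q8 : q8V * q8 = 1.
Proof. exact: presGen_mul1 (xrel_QVQ R). Qed.

Lemma q8_central u : GRing.comm q8 u.
Proof. exact: presGen_central (xrel_Qcentral R) u. Qed.

Lemma q8V_central u : GRing.comm q8V u.
Proof. exact: comm_inv q8_q8V q8V_q8 (q8_central u). Qed.

Lemma Zh_arrow a b : arrow a b -> Zh b * Zh a = q8V ^+ 4 * (Zh a * Zh b).
Proof. by move=> ab; apply: presGen_qcomm (xrel_arrow R ab). Qed.

Lemma Zh_comm a b : ~~ arrow a b -> ~~ arrow b a -> GRing.comm (Zh b) (Zh a).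
Proof. by move=> ab ba; apply: presGen_comm (xrel_comm R ab ba). Qed.

Lemma torus_central (z : X) :
  (forall a, GRing.comm z (Zh a)) -> forall u, GRing.comm z u.
Proof.
move=> zZ; apply: presAlg_central => -[a|a||]; first exact: zZ.
- exact/commr_sym/(comm_inv (Zh_ZhV a) (ZhV_Zh a))/commr_sym/zZ.
- exact/commr_sym/q8_central.
- exact/commr_sym/q8V_central.
Qed.

Lemma Zh_central a : (forall b, ~~ arrow a b) -> (forall b, ~~ arrow b a) ->
  forall u, GRing.comm (Zh a) u.
Proof. by move=> ab ba; apply: torus_central => b; apply: Zh_comm. Qed.

Lemma ZhV_central a : (forall b, ~~ arrow a b) -> (forall b, ~~ arrow b a) ->
  forall u, GRing.comm (ZhV a) u.
Proof.
by move=> ab ba u; apply: comm_inv (Zh_ZhV a) (ZhV_Zh a) _; apply: Zh_central.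
Qed.

Let s : X := q8V ^+ 4.
Let r : X := q8 ^+ 4.
Let sC u : GRing.comm s u. Proof. exact/commr_sym/commrX/commr_sym/q8V_central. Qed.
Let rC u : GRing.comm r u. Proof. exact/commr_sym/commrX/commr_sym/q8_central. Qed.
Let powV n : q8V ^+ n * q8 ^+ n = 1.
Proof.
rewrite -exprMn_comm; last exact: q8V_central.
by rewrite q8V_q8 expr1n.
Qed.
Let sr : s * r = 1. Proof. exact: powV. Qed.
Let rs : r * s = 1. Proof. by rewrite rC sr. Qed.
Let xqC u : GRing.comm (xq R) u. Proof. exact/commr_sym/commrX/commr_sym/q8_central. Qed.
Let xqVC u : GRing.comm (xqV R) u. Proof. exact/commr_sym/commrX/commr_sym/q8V_central. Qed.
Let xq_xqV : xq R * xqV R = 1. Proof. by rewrite xqC; apply: powV. Qed.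

(** Z_{O1}, Z_{B1}, Z_{G1} touch no arrow, and the three vertices of the cycle enter with equal
    exponents. *)
Lemma tinf_central u : GRing.comm (tinf R) u.
Proof.
have [wO wB wG] := square_prod_central sC rC sr rs
  (Zh_arrow (a := O2) (b := G2) isT) (Zh_arrow (a := G2) (b := B2) isT)
  (Zh_arrow (a := B2) (b := O2) isT).
move: u; apply: torus_central => a.
have cen b : (forall c, ~~ arrow b c) -> (forall c, ~~ arrow c b) -> GRing.comm (Zh a) (Zh b).
  by move=> bc cb; apply/commr_sym/Zh_central.
have -> : tinf R = xq R * Zh O1 * Zh B1 * Zh G1 *
    (Zh O2 ^+ 2 * (Zh B2 ^+ 2 * Zh G2 ^+ 2)) by rewrite [RHS]mulrA [RHS]mulrA.
apply: commr_sym; apply: commrM.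
  apply: commrM; last by apply: cen => -[].
  apply: commrM; last by apply: cen => -[].
  by apply: commrM; [exact/commr_sym/xqC | apply: cen => -[]].
apply: commr_sym; case: a {cen} => //; apply: commr_sym; by apply: Zh_central => -[].
Qed.

Let half2 a : Z R a * ZV R a = 1.
Proof.
rewrite /Z /ZV -exprMn_comm; last by rewrite /GRing.comm Zh_ZhV ZhV_Zh.
by rewrite Zh_ZhV expr1n.
Qed.

Let half2V a : ZV R a * Z R a = 1.
Proof.
rewrite /Z /ZV -exprMn_comm; last by rewrite /GRing.comm Zh_ZhV ZhV_Zh.
by rewrite ZhV_Zh expr1n.
Qed.

Let Zarrow a b : arrow a b -> Z R b * Z R a = xqV R * (xqV R * (Z R a * Z R b)).
Proof.
move=> ab; have xqVE : xqV R = s ^+ 2 by rewrite /s -exprM.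
rewrite /Z (qcomm_squares sC (Zh_arrow ab)) xqVE [RHS]mulrA; congr (_ * _).
exact: (exprD s 2 2).
Qed.

Lemma torus_representation :
  [/\ \det (Obar R) = 1, \det (Bbar R) = 1, \det (Gbar R) = 1 & \det (Pbar R) = 1] /\
  [/\ (Obar R - (Zh O1)%:M) *m (Obar R - (ZhV O1)%:M) = 0,
      (Bbar R - (Zh B1)%:M) *m (Bbar R - (ZhV B1)%:M) = 0,
      (Gbar R - (Zh G1)%:M) *m (Gbar R - (ZhV G1)%:M) = 0,
      (Pbar R - (tinf R)%:M) *m (Pbar R - (tinfV R)%:M) = 0
    & Obar R *m Bbar R *m Gbar R *m Pbar R = (xqV R)%:M] /\
  exists phi : {rmorphism HD4 R -> 'M[X]_2},
    (forall h, phi (presGen (@hrel R) h) =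
      hgen_image (Zh O1) (ZhV O1) (Zh B1) (ZhV B1) (Zh G1) (ZhV G1) (xq R) (xqV R)
        (Z R O2) (ZV R O2) (Z R B2) (ZV R B2) (Z R G2) (ZV R G2) h) /\
    (forall k x, phi (k *: x) = (scalar_of (@xrel R) k)%:M * phi x).
Proof.
have cenZ a : (forall b, ~~ arrow a b) -> (forall b, ~~ arrow b a) ->
    (forall u, GRing.comm (Zh a) u) /\ (forall u, GRing.comm (ZhV a) u).
  by move=> ab ba; split=> u; [apply: Zh_central | apply: ZhV_central].
have [OC OVC] : (forall u, GRing.comm (Zh O1) u) /\ (forall u, GRing.comm (ZhV O1) u).
  by apply: cenZ => -[].
have [BC BVC] : (forall u, GRing.comm (Zh B1) u) /\ (forall u, GRing.comm (ZhV B1) u).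
  by apply: cenZ => -[].
have [GC GVC] : (forall u, GRing.comm (Zh G1) u) /\ (forall u, GRing.comm (ZhV G1) u).
  by apply: cenZ => -[].
exact: (@D4_representation X (Zh O1) (ZhV O1) (Zh B1) (ZhV B1) (Zh G1) (ZhV G1)
  (xq R) (xqV R) (Z R O2) (ZV R O2) (Z R B2) (ZV R B2) (Z R G2) (ZV R G2)
  OC OVC BC BVC GC GVC xqC xqVC (Zh_ZhV O1) (Zh_ZhV B1) (Zh_ZhV G1) xq_xqV
  (half2 O2) (half2V O2) (half2 B2) (half2V B2) (half2 G2) (half2V G2)
  (@Zarrow O2 G2 isT) (@Zarrow G2 B2 isT) (@Zarrow B2 O2 isT) tinf_central
  R (scalar_of (@xrel R)) (scalar_of_central (rel := @xrel R))).
Qed.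

End Torus.

(** * A model of the quantum torus by operators on functions on a lattice *)

Section LinearOperators.
Variables (F : comNzRingType) (T : Type).

Definition pointwise_linear (h : (T -> F) -> T -> F) :=
  forall a f g y, h (fun z => a * f z + g z) y = a * h f y + h g y.

(** Operators act on all functions, without finiteness of support, so that every map of [T] acts by
    precomposition. *)
Record linop := LinOp { linop_fun :> (T -> F) -> T -> F; _ : pointwise_linear linop_fun }.

HB.instance Definition _ := gen_eqMixin linop.
HB.instance Definition _ := gen_choiceMixin linop.

Lemma linopP (h : linop) : pointwise_linear h. Proof. by case: h. Qed.

Lemma linop_ext (h k : linop) : (forall f y, h f y = k f y) -> h = k.
Proof.
case: h k => [h hl] [k kl] /= E; have {}E : h = k by apply/funext=> f; apply/funext=> y.
by move: hl kl; rewrite E => hl kl; congr LinOp; apply: Prop_irrelevance.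
Qed.

Fact lin0 : pointwise_linear (fun _ _ => 0).
Proof. by move=> a f g y; rewrite mulr0 addr0. Qed.
Fact lin1 : pointwise_linear (fun f => f).
Proof. by []. Qed.
Fact linN (h : linop) : pointwise_linear (fun f y => - h f y).
Proof. by move=> a f g y; rewrite linopP opprD mulrN. Qed.
Fact linD (h k : linop) : pointwise_linear (fun f y => h f y + k f y).
Proof. by move=> a f g y; rewrite !linopP mulrDr addrACA. Qed.
Fact linM (h k : linop) : pointwise_linear (fun f => h (k f)).
Proof.
move=> a f g y; rewrite -linopP; congr (h _ y).
by apply/funext => z; rewrite linopP.
Qed.
Fact linS (c : F) : pointwise_linear (fun f y => c * f y).
Proof. by move=> a f g y; rewrite mulrDr mulrCA. Qed.
Fact lin_comp (s : T -> T) : pointwise_linear (fun f y => f (s y)).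
Proof. by []. Qed.

Definition linop0 := LinOp lin0.
Definition linop1 := LinOp lin1.
Definition linopN h := LinOp (linN h).
Definition linopD h k := LinOp (linD h k).
Definition linopM h k := LinOp (linM h k).
Definition linopS c := LinOp (linS c).
Definition linop_comp s := LinOp (lin_comp s).

Lemma linop_fun0 (h : linop) y : h (fun=> 0) y = 0.
Proof.
have := linopP h (-1) (fun=> 0) (fun=> 0) y.
have -> : (fun _ : T => -1 * 0 + 0) = (fun=> 0) :> (T -> F).
  by apply/funext => z; rewrite mulr0 addr0.
by rewrite mulN1r addNr.
Qed.

Lemma linop_funD (h : linop) f g y : h (fun z => f z + g z) y = h f y + h g y.
Proof.
rewrite -[h f y]mul1r -linopP; congr (h _ y).
by apply/funext => z; rewrite mul1r.
Qed.

Fact linopDA : associative linopD.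
Proof. by move=> h k l; apply: linop_ext => f y /=; rewrite addrA. Qed.
Fact linopDC : commutative linopD.
Proof. by move=> h k; apply: linop_ext => f y /=; rewrite addrC. Qed.
Fact linop0D : left_id linop0 linopD.
Proof. by move=> h; apply: linop_ext => f y /=; rewrite add0r. Qed.
Fact linopND : left_inverse linop0 linopN linopD.
Proof. by move=> h; apply: linop_ext => f y /=; rewrite addNr. Qed.
HB.instance Definition _ := GRing.isZmodule.Build linop linopDA linopDC linop0D linopND.

Fact linopMA : associative linopM.
Proof. by move=> h k l; apply: linop_ext. Qed.
Fact linop1M : left_id linop1 linopM.
Proof. by move=> h; apply: linop_ext. Qed.
Fact linopM1 : right_id linop1 linopM.
Proof. by move=> h; apply: linop_ext. Qed.
Fact linopMDl : left_distributive linopM linopD.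
Proof. by move=> h k l; apply: linop_ext. Qed.
Fact linopMDr : right_distributive linopM linopD.
Proof. by move=> h k l; apply: linop_ext => f y /=; rewrite -linop_funD. Qed.
HB.instance Definition _ := GRing.Zmodule_isPzRing.Build linop
  linopMA linop1M linopM1 linopMDl linopMDr.

Fact linopS_zmod : {morph linopS : a b / a - b}.
Proof. by move=> a b; apply: linop_ext => f y /=; rewrite mulrBl. Qed.
Fact linopS_monoid : monoid_morphism linopS.
Proof.
split=> [|a b]; apply: linop_ext => f y; first exact: mul1r.
by rewrite /= mulrA.
Qed.
HB.instance Definition _ := GRing.isZmodMorphism.Build F linop linopS linopS_zmod.
HB.instance Definition _ := GRing.isMonoidMorphism.Build F linop linopS linopS_monoid.

Lemma linopDE (h k : linop) f y : (h + k) f y = h f y + k f y. Proof. by []. Qed.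
Lemma linopNE (h : linop) f y : (- h) f y = - h f y. Proof. by []. Qed.
Lemma linopME (h k : linop) f y : (h * k) f y = h (k f) y. Proof. by []. Qed.

Lemma linopS_central c (h : linop) : GRing.comm (linopS c) h.
Proof.
apply: linop_ext => f y; rewrite /=.
rewrite -[c * _]addr0 -[X in _ + X](linop_fun0 h y) -linopP; congr (h _ y).
by apply/funext => z; rewrite addr0.
Qed.

(** Precomposition reverses the order, so the leftmost factor of a product moves the point first. *)
Lemma linop_compM s t : linop_comp s * linop_comp t = linop_comp (t \o s).
Proof. exact: linop_ext. Qed.

Lemma linop_comp_exp s n : linop_comp s ^+ n = linop_comp (iter n s).
Proof.
elim: n => [|n IHn]; first by rewrite expr0; apply: linop_ext.
by rewrite exprSr IHn linop_compM.
Qed.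

Lemma linop_comp1 : linop_comp id = 1.
Proof. exact: linop_ext. Qed.

End LinearOperators.

(** Exponents of the square roots Z_a^{1/2} in the order O1, B1, G1, O2, B2, G2; a state adds the
    exponent of q^{1/8}. *)
Definition expo : Type := (int * int * int * int * int * int)%type.
Definition state : Type := (expo * int)%type.

Definition eadd (x d : expo) : expo :=
  let: (a, b, c, u, v, w) := x in let: (a', b', c', u', v', w') := d in
  (a + a', b + b', c + c', u + u', v + v', w + w').

(* Half the degree of the torus in the noncentral variables O2, B2, G2. *)
Definition deg (x : expo) : int := let: (_, _, _, u, v, w) := x in u + v + w.

Lemma degD x d : deg (eadd x d) = deg x + deg d.
Proof. by case: x => -[[[[? ?] ?] ?] ?] ?; case: d => -[[[[? ?] ?] ?] ?] ? /=; lia. Qed.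

Lemma eaddA x y z : eadd x (eadd y z) = eadd (eadd x y) z.
Proof.
case: x => -[[[[? ?] ?] ?] ?] ?; case: y => -[[[[? ?] ?] ?] ?] ?.
by case: z => -[[[[? ?] ?] ?] ?] ? /=; rewrite !addrA.
Qed.

Definition tr (d : expo) (l : expo -> int) (y : state) : state :=
  (eadd y.1 d, y.2 + l y.1).

Lemma tr_comp d l d' l' :
  tr d' l' \o tr d l = tr (eadd d d') (fun x => l x + l' (eadd x d)).
Proof. by apply/funext => -[x k]; rewrite /tr /= eaddA addrA. Qed.

Definition vexp (a : vertex) (e : int) : expo :=
  match a with
  | O1 => (e, 0, 0, 0, 0, 0) | B1 => (0, e, 0, 0, 0, 0) | G1 => (0, 0, e, 0, 0, 0)
  | O2 => (0, 0, 0, e, 0, 0) | B2 => (0, 0, 0, 0, e, 0) | G2 => (0, 0, 0, 0, 0, e)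
  end.

(** A bilinear cocycle whose antisymmetrization gives the commutation exponents of the quiver. As
    [vtwist a] ignores the coordinate of [a], the shifts of [gZ a] and [gZV a] are inverse to each
    other. *)
Definition vtwist (a : vertex) (x : expo) : int :=
  let: (_, _, _, u, v, w) := x in
  match a with O2 => w | G2 => v | B2 => u | _ => 0 end.

Definition xgen_shift (g : xgen) : state -> state :=
  match g with
  | gZ a => tr (vexp a 1) (fun x => - 4 * vtwist a x)
  | gZV a => tr (vexp a (- 1)) (fun x => 4 * vtwist a x)
  | gQ8 => tr (0, 0, 0, 0, 0, 0) (fun=> 1)
  | gQ8V => tr (0, 0, 0, 0, 0, 0) (fun=> - 1)
  end.

Section TorusOperators.
Variable R : realType.
Local Notation X := (XQ2 R).
Local Notation E := (linop R[i] state).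
Local Notation op := (@linop_comp R[i] state).
Local Notation ev := (freeEval (@linopS R[i] state) (fun g => op (xgen_shift g))).

(** Nothing is known a priori about collapse in the presented torus; this representation makes its
    monomials distinguishable. *)
Lemma torus_operators : exists2 rho : {rmorphism X -> E},
  forall g, rho (presGen (@xrel R) g) = op (xgen_shift g) &
  forall c x, rho (c *: x) = linopS state c * rho x.
Proof.
pose g0 g := op (xgen_shift g).
have iC c x : linopS state c * g0 x = g0 x * linopS state c by apply: linopS_central.
have eM f h : ev (f * h) = ev f * ev h by exact: freeEvalM iC f h.
have e1 : ev 1 = 1 by exact: freeEval1.
have eg x : ev (freeGen R[i] x) = op (xgen_shift x) by exact: freeEval_gen.
have eX x n : ev (freeGen R[i] x ^+ n) = op (xgen_shift x) ^+ n.
  by elim: n => [|n IHn]; rewrite ?expr0 ?e1 // !exprS eM eg IHn.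
have relE f h : @xrel R f h -> ev f = ev h.
  case=> [a|a|||g|a b ab|a b ab ba].
  - rewrite [RHS]e1 [LHS]eM !eg linop_compM -linop_comp1; congr op.
    apply/funext => -[[[[[[x1 x2] x3] x4] x5] x6] k].
    by case: a; rewrite /= /tr /=; do ?[congr (_, _)]; lia.
  - rewrite [RHS]e1 [LHS]eM !eg linop_compM -linop_comp1; congr op.
    apply/funext => -[[[[[[x1 x2] x3] x4] x5] x6] k].
    by case: a; rewrite /= /tr /=; do ?[congr (_, _)]; lia.
  - rewrite [RHS]e1 [LHS]eM !eg linop_compM -linop_comp1; congr op.
    apply/funext => -[[[[[[x1 x2] x3] x4] x5] x6] k].
    by rewrite /= /tr /=; do ?[congr (_, _)]; lia.
  - rewrite [RHS]e1 [LHS]eM !eg linop_compM -linop_comp1; congr op.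
    apply/funext => -[[[[[[x1 x2] x3] x4] x5] x6] k].
    by rewrite /= /tr /=; do ?[congr (_, _)]; lia.
  - rewrite [LHS]eM [RHS]eM !eg !linop_compM; congr op.
    apply/funext => -[[[[[[x1 x2] x3] x4] x5] x6] k].
    by case: g => [[]|[]||]; rewrite /= /tr /=; do ?[congr (_, _)]; lia.
  - rewrite [LHS]eM [RHS]eM [X in _ = X * _]eM eX !eg linop_comp_exp !linop_compM; congr op.
    apply/funext => -[[[[[[x1 x2] x3] x4] x5] x6] k].
    by case: a b ab => -[] // _; rewrite /= /tr /=; do ?[congr (_, _)]; lia.
  - rewrite [LHS]eM [RHS]eM !eg !linop_compM; congr op.
    apply/funext => -[[[[[[x1 x2] x3] x4] x5] x6] k].
    by case: a b ab ba => -[] // _ _; rewrite /= /tr /=; do ?[congr (_, _)]; lia.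
have [rho rhoE rhoZ] := presAlg_universal iC relE.
by exists rho.
Qed.

End TorusOperators.

(** * Degree filtration and leading terms of words *)

Section MapMatrices.
Variables (A B : pzRingType) (f : {rmorphism A -> B}).

Lemma map_mx22 a b c d : map_mx f (mx22 a b c d) = mx22 (f a) (f b) (f c) (f d).
Proof. by apply: mx22P; rewrite !mxE. Qed.

Lemma map_Omx al alV o oV :
  map_mx f (Omx al alV o oV) = Omx (f al) (f alV) (f o) (f oV).
Proof. by rewrite map_mx22 rmorph0 rmorphN rmorphD !rmorphM. Qed.

Lemma map_Bmx be beV b bV :
  map_mx f (Bmx be beV b bV) = Bmx (f be) (f beV) (f b) (f bV).
Proof. by rewrite map_mx22 !rmorphN !rmorphD !rmorphM. Qed.

Lemma map_Gmx ga gaV g gV :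
  map_mx f (Gmx ga gaV g gV) = Gmx (f ga) (f gaV) (f g) (f gV).
Proof. by rewrite map_mx22 !(rmorphN, rmorphD) !rmorphM. Qed.
End MapMatrices.

Section Filtration.
Variable F : comNzRingType.
Local Notation E := (linop F state).
Local Notation op := (@linop_comp F state).
Local Notation S := (@linopS F state).

(* Operators that raise the degree of the base point by at most [n]. *)
Definition filt (n : int) (h : E) := forall f (y : state),
  (forall z : state, deg z.1 <= n + deg y.1 -> f z = 0) -> h f y = 0.

Lemma filt_le m n h : m <= n -> filt m h -> filt n h.
Proof. by move=> mn hm f y f0; apply: hm => z zy; apply: f0; lia. Qed.

Lemma filt0 n : filt n 0.
Proof. by []. Qed.

Lemma filtD n h k : filt n h -> filt n k -> filt n (h + k).
Proof. by move=> hn kn f y f0; rewrite linopDE hn // kn // addr0. Qed.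

Lemma filtN n h : filt n h -> filt n (- h).
Proof. by move=> hn f y f0; rewrite linopNE hn // oppr0. Qed.

Lemma filtB n h k : filt n h -> filt n k -> filt n (h - k).
Proof. by move=> hn kn; apply: filtD => //; apply: filtN. Qed.

Lemma filtS n c h : filt n h -> filt n (S c * h).
Proof. by move=> hn f y f0; rewrite linopME /= hn // mulr0. Qed.

Lemma filtM m n h k : filt m h -> filt n k -> filt (m + n) (h * k).
Proof.
move=> hm kn f y f0; rewrite linopME; apply: hm => z zy; apply: kn => t tz.
by apply: f0; lia.
Qed.

(* A monomial of exponent [d], up to a power of q depending on the position. *)
Definition mono (d : expo) (h : E) := exists l, h = op (tr d l).

Lemma mono_filt d h : mono d h -> filt (deg d) h.
Proof.
by move=> [l ->] f y f0 /=; apply: f0; rewrite degD addrC.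
Qed.

Lemma monoM d d' h h' : mono d h -> mono d' h' -> mono (eadd d d') (h * h').
Proof. by move=> [l ->] [l' ->]; rewrite linop_compM tr_comp; eexists. Qed.

(* [M] is [N] times a monomial of exponent [d], up to terms of lower degree. *)
Definition top (M : 'M[E]_2) d l (N : 'I_2 -> 'I_2 -> int) :=
  forall i j, filt (deg d - 1) (M i j - S (N i j)%:~R * op (tr d l)).

Definition has_top M d N := exists l, top M d l N.

Lemma top_mul M d l N M' d' l' N' : top M d l N -> top M' d' l' N' ->
  top (M *m M') (eadd d d') (fun x => l x + l' (eadd x d))
    (fun i j => N i ord0 * N' ord0 j + N i ord_max * N' ord_max j).
Proof.
move=> t t' i j.
have l2 : lift ord0 ord0 = ord_max :> 'I_2 by apply/val_inj.
rewrite mxE !big_ord_recl big_ord0 addr0 l2 -tr_comp -linop_compM.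
have key k : filt (deg (eadd d d') - 1) (M i k * M' k j -
    S (N i k * N' k j)%:~R * (op (tr d l) * op (tr d' l'))).
  set a := M i k; set b := M' k j; pose a0 := S (N i k)%:~R * op (tr d l).
  pose b0 := S (N' k j)%:~R * op (tr d' l').
  have -> : S (N i k * N' k j)%:~R * (op (tr d l) * op (tr d' l')) = a0 * b0.
    rewrite /a0 /b0 intrM rmorphM -!mulrA; congr (_ * _).
    by rewrite [RHS]mulrA -(linopS_central _ (op (tr d l))) -mulrA.
  (* Each summand contains one error factor, which lowers the degree by one. *)
  have -> : a * b - a0 * b0 = (a - a0) * b + a0 * (b - b0).
    by rewrite mulrBl mulrBr addrA subrK.
  have fa0 : filt (deg d) a0 by apply: filtS; apply: mono_filt; exists l.
  have fb0 : filt (deg d') b0 by apply: filtS; apply: mono_filt; exists l'.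
  have fb : filt (deg d') b.
    rewrite -[b](subrK b0); apply: filtD => //; apply: filt_le (t' k j); lia.
  rewrite degD; apply: filtD.
    have -> : deg d + deg d' - 1 = (deg d - 1) + deg d' by lia.
    by apply: filtM => //; apply: t.
  have -> : deg d + deg d' - 1 = deg d + (deg d' - 1) by lia.
  by apply: filtM => //; apply: t'.
rewrite intrD rmorphD mulrDl opprD addrACA; apply: filtD; exact: key.
Qed.

Lemma topM M d N M' d' N' : has_top M d N -> has_top M' d' N' ->
  has_top (M *m M') (eadd d d')
    (fun i j => N i ord0 * N' ord0 j + N i ord_max * N' ord_max j).
Proof. by move=> [l t] [l' t']; eexists; apply: top_mul t t'. Qed.

Lemma has_top_ext M d N N' : (forall i j, N i j = N' i j) -> has_top M d N -> has_top M d N'.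
Proof. by move=> NN [l t]; exists l => i j; rewrite -NN. Qed.

(** The leading matrix of each letter has rank one, the column [lv x] times the row [lw x]. *)
Definition lv (x : letter) (i : 'I_2) : int :=
  let: (a, b) := match x with L0 => (0, - 1) | L1 => (1, 0) | L2 => (1, - 1) end in
  if i == ord0 then a else b.

Definition lw (x : letter) (i : 'I_2) : int :=
  let: (a, b) := match x with L0 => (1, 0) | L1 => (0, 1) | L2 => (1, 1) end in
  if i == ord0 then a else b.

Definition lexp (x : letter) : expo :=
  match x with
  | L0 => (1, 0, 0, 2, 0, 0) | L1 => (0, 1, 0, 0, 2, 0) | L2 => (0, 0, 1, 0, 0, 2)
  end.

Variables al alV be beV ga gaV o oV b bV g gV : E.
Hypothesis Hal : mono (1, 0, 0, 0, 0, 0) al.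
Hypothesis HalV : mono (- 1, 0, 0, 0, 0, 0) alV.
Hypothesis Hbe : mono (0, 1, 0, 0, 0, 0) be.
Hypothesis HbeV : mono (0, - 1, 0, 0, 0, 0) beV.
Hypothesis Hga : mono (0, 0, 1, 0, 0, 0) ga.
Hypothesis HgaV : mono (0, 0, - 1, 0, 0, 0) gaV.
Hypothesis Ho : mono (0, 0, 0, 2, 0, 0) o.
Hypothesis HoV : mono (0, 0, 0, - 2, 0, 0) oV.
Hypothesis Hb : mono (0, 0, 0, 0, 2, 0) b.
Hypothesis HbV : mono (0, 0, 0, 0, - 2, 0) bV.
Hypothesis Hg : mono (0, 0, 0, 0, 0, 2) g.
Hypothesis HgV : mono (0, 0, 0, 0, 0, - 2) gV.

Let low d h : deg d <= 1 -> mono d h -> filt 1 h.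
Proof. by move=> d1 /mono_filt; apply: filt_le. Qed.

Let low2 d d' h h' : deg d + deg d' <= 1 -> mono d h -> mono d' h' -> filt 1 (h * h').
Proof. by move=> dd hm hm'; apply: low (monoM hm hm'); rewrite degD. Qed.

Definition lmx (x : letter) : 'M[E]_2 :=
  match x with L0 => Omx al alV o oV | L1 => Bmx be beV b bV | L2 => Gmx ga gaV g gV end.

Lemma mono_top x d (M : 'M[E]_2) (N : 'I_2 -> 'I_2 -> int) : mono d x -> deg d = 2 ->
  (forall i j, filt 1 (M i j - S (N i j)%:~R * x)) -> has_top M d N.
Proof. by move=> [l ->] d2 h; exists l => i j; rewrite d2. Qed.

Lemma lmx_top x : has_top (lmx x) (lexp x) (fun i j => lv x i * lw x j).
Proof.
case: x.
- apply: (mono_top (x := al * o)) => //; first exact: monoM Hal Ho.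
  elim/I2P; elim/I2P; rewrite !mxE /lv /lw /=
    !(mulr0, mul0r, mulr1, mul1r, mulr0z, mulr1z, mulrN1z, rmorph0, rmorph1, subr0,
      rmorphN1, mulN1r, opprK, addNr).
  + exact: filt0.
  + exact: low2 HalV HoV.
  + exact: filt0.
  + by apply: filtD; [apply: low Hal | apply: low HalV].
- have lB : filt 1 (be + beV + beV * bV).
    apply: filtD; last exact: low2 HbeV HbV.
    by apply: filtD; [apply: low Hbe | apply: low HbeV].
  apply: (mono_top (x := be * b)) => //; first exact: monoM Hbe Hb.
  elim/I2P; elim/I2P; rewrite !mxE /lv /lw /=
    !(mulr0, mul0r, mulr1, mul1r, mulr0z, mulr1z, mulrN1z, rmorph0, rmorph1, subr0,
      rmorphN1, mulN1r, opprK, addNr).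
  + exact: lB.
  + by rewrite addrK; apply: lB.
  + by apply: filtN; apply: low2 HbeV HbV.
  + by apply: filtN; apply: low2 HbeV HbV.
- have lG : filt 1 (ga + gaV).
    by apply: filtD; [apply: low Hga | apply: low HgaV].
  apply: (mono_top (x := ga * g)) => //; first exact: monoM Hga Hg.
  elim/I2P; elim/I2P; rewrite !mxE /lv /lw /=
    !(mulr0, mul0r, mulr1, mul1r, mulr0z, mulr1z, mulrN1z, rmorph0, rmorph1, subr0,
      rmorphN1, mulN1r, opprK, addNr).
  + by rewrite addrK; apply: lG.
  + by rewrite subrr; apply: filt0.
  + rewrite subrK -opprD; apply: filtB; first exact: filtN.
    exact: low2 HgaV HgV.
  + exact: filt0.
Qed.

Definition wexp (s : seq letter) : expo :=
  let n x := (count_mem x s)%:Z in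
  (n L0, n L1, n L2, 2 * n L0, 2 * n L1, 2 * n L2).

Lemma lexpE x : lexp x = wexp [:: x].
Proof. by case: x. Qed.

Lemma wexp_cat s s' : wexp (s ++ s') = eadd (wexp s) (wexp s').
Proof. by rewrite /wexp /= !count_cat; do ?[congr (_, _)]; lia. Qed.

Definition wmx (s : seq letter) : 'M[E]_2 := \prod_(x <- s) lmx x.

(** These scalars arise between neighbouring rank-one factors; since they are signs, the leading
    term of a word without repeated neighbours survives. *)
Lemma lwv_sign x y : y != x ->
  lw x ord0 * lv y ord0 + lw x ord_max * lv y ord_max = 1 \/
  lw x ord0 * lv y ord0 + lw x ord_max * lv y ord_max = - 1.
Proof. by case: x y => -[] // _; first [left; reflexivity | right; reflexivity]. Qed.

Lemma wmx_top x s : path (fun y z => y != z) x s ->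
  exists e : int, (e = 1 \/ e = - 1) /\
  has_top (wmx (x :: s)) (wexp (x :: s)) (fun i j => e * (lv x i * lw (last x s) j)).
Proof.
elim: s x => [|y s IHs] x /=.
  move=> _; exists 1; split; first by left.
  rewrite /wmx big_seq1 -lexpE; apply: has_top_ext (lmx_top x) => i j.
  by rewrite mul1r.
move=> /andP[xy /IHs[e [e1 t]]].
pose p := lw x ord0 * lv y ord0 + lw x ord_max * lv y ord_max.
have p1 : p = 1 \/ p = - 1.
  by apply: lwv_sign; rewrite eq_sym.
exists (e * p); split; first by case: e1 p1 => -> [] ->; [left|right|right|left].
rewrite /wmx big_cons -[x :: y :: s]/([:: x] ++ y :: s) wexp_cat -lexpE.
apply: has_top_ext (topM (lmx_top x) t) => i j; rewrite /p; ring.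
Qed.

End Filtration.

(** * Leading matrices of sorted words and the functionals separating them *)

HB.instance Definition _ := gen_eqMixin sword.

(** The leading matrix up to sign: column of the first letter times row of the last one. *)
Definition smat (s : sword) (i j : 'I_2) : int :=
  match s with
  | SId => (i == j)%:Z
  | SCC b _ _ => lv b i * lw b j
  | SXC b _ _ => lv (pv b) i * lw b j
  | SCX0 b _ => lv b i * lw (pv b) j
  | SCX b _ _ => lv b i * lw (nx b) j
  | SXX b _ _ => lv (pv b) i * lw (nx b) j
  end.

Definition scount (s : sword) (x : letter) : nat :=
  match s with
  | SId => 0
  | SCC b m n => m * (x == pv b) + (m + n).+1 * (x == b) + n * (x == nx b)
  | SXC b m n => m.+1 * (x == pv b) + (m.+1 + n) * (x == b) + n * (x == nx b)
  | SCX0 b m => m.+1 * (x == pv b) + m.+1 * (x == b)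
  | SCX b m n => m.+1 * (x == pv b) + (m + n).+2 * (x == b) + n.+1 * (x == nx b)
  | SXX b m n => m.+1 * (x == pv b) + (m.+1 + n) * (x == b) + n.+1 * (x == nx b)
  end.

Lemma count_pw x a b m : count_mem x (pw a b m) = (m * ((x == a) + (x == b)))%N.
Proof.
elim: m => //= m ->; rewrite (eq_sym a) (eq_sym b) mulSn; lia.
Qed.

Lemma count_sword s x : count_mem x (sword_seq s) = scount s x.
Proof.
case: s => [|b m n|b m n|b m|b m n|b m n] //=;
by rewrite ?count_cat /= ?count_cat ?count_pw /= ?(eq_sym b) ?(eq_sym (pv b)) ?(eq_sym (nx b)); lia.
Qed.

Lemma path_pw a b m : a != b -> path (fun y z : letter => y != z) b (pw a b m).
Proof. by move=> ab; elim: m => //= m IHm; rewrite ab eq_sym ab. Qed.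

Lemma last_pw a b m : last b (pw a b m) = b.
Proof. by elim: m. Qed.

Lemma pv_neq b : pv b != b. Proof. by case: b. Qed.
Lemma nx_neq b : nx b != b. Proof. by case: b. Qed.

Section WordTops.
Variable F : comNzRingType.
Variables al alV be beV ga gaV o oV b bV g gV : linop F state.
Local Notation wmx := (wmx al alV be beV ga gaV o oV b bV g gV).
Hypothesis wtop : forall x s, path (fun y z => y != z) x s ->
  exists e : int, (e = 1 \/ e = - 1) /\
  has_top (wmx (x :: s)) (wexp (x :: s)) (fun i j => e * (lv x i * lw (last x s) j)).

Lemma sword_top s : exists e : int, (e = 1 \/ e = - 1) /\
  has_top (wmx (sword_seq s)) (wexp (sword_seq s)) (fun i j => e * smat s i j).
Proof.
have pn := pv_neq; have nn := nx_neq; have np x : x != pv x by rewrite eq_sym.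
have nn' x : x != nx x by rewrite eq_sym.
case: s => [|x m n|x m n|x m|x m n|x m n] /=.
- exists 1; split; first by left.
  exists (fun=> 0) => i j; rewrite /wmx /wmx big_nil mxE mul1r.
  have -> : tr (wexp [::]) (fun=> 0) = id.
    by apply/funext => -[[[[[[x1 x2] x3] x4] x5] x6] k]; rewrite /tr /=; do ?[congr (_, _)]; lia.
  rewrite linop_comp1 mulr1 -natz.
  by case: (i == j); rewrite ?rmorph1 ?rmorph0 subrr; apply: filt0.
- have := wtop (x := x) (s := pw (pv x) x m ++ pw (nx x) x n).
  by rewrite cat_path last_cat !last_pw !path_pw //; apply.
- have := wtop (x := pv x) (s := x :: pw (pv x) x m ++ pw (nx x) x n).
  by rewrite /= cat_path last_cat !last_pw !path_pw // pn; apply.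
- have := wtop (x := x) (s := pv x :: pw x (pv x) m).
  by rewrite /= last_pw !path_pw // np; apply.
- have := wtop (x := x) (s := swordXX x m n).
  rewrite /swordXX /= cat_path last_cat cat_path last_cat !last_pw !path_pw //=.
  by rewrite pn np nn'; apply.
- have := wtop (x := pv x) (s := x :: pw (pv x) x m ++ pw (nx x) x n ++ [:: nx x]).
  rewrite /= cat_path last_cat cat_path last_cat !last_pw !path_pw //=.
  by rewrite pn nn'; apply.
Qed.
End WordTops.

(* Within one exponent class modulo (1,1,1) there are exactly four sorted     *)
(* words; [dual] is, up to scaling, the basis dual to their leading matrices. *)
Definition dual (s : sword) : int * int * int * int :=
  match s with
  | SId | SXC _ _ 0 => (0, 1, - 1, 1)
  | SCC b _ _ => match b with
      L0 => (1, 0, 1, 0) | L1 => (1, - 1, 0, 0) | L2 => (0, 0, 0, 1) end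
  | SXC b _ _ => match b with
      L0 => (1, 0, 0, 0) | L1 => (0, 0, 1, - 1) | L2 => (0, 1, 0, 1) end
  | SCX0 b _ | SCX b _ _ => match b with
      L0 => (0, 1, 0, 1) | L1 => (1, 0, 0, 0) | L2 => (0, 0, 1, - 1) end
  | SXX b _ _ => match b with
      L0 => (0, 1, 0, 0) | L1 => (0, 0, 1, 0) | L2 => (1, - 1, 1, - 1) end
  end.

Definition pairing (q : int * int * int * int) (N : 'I_2 -> 'I_2 -> int) : int :=
  let: (a, b, c, d) := q in
  a * N ord0 ord0 + b * N ord0 ord_max + c * N ord_max ord0 + d * N ord_max ord_max.

Lemma dual_self s : pairing (dual s) (smat s) != 0.
Proof. by case: s => [|[] ? ?|[] ? []|[] ?|[] ? ?|[] ? ?]. Qed.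

(** The hypothesis is equality of letter counts modulo (1,1,1), the ambiguity created by powers of
    t_4. *)
Lemma dual_orth s s0 (d d0 : int) :
  (forall x, (scount s x)%:Z + d = (scount s0 x)%:Z + d0) ->
  s = s0 \/ pairing (dual s0) (smat s) = 0.
Proof.
move=> h; have := h L0; have := h L1; have := h L2; clear h.
case: s => [|[] m n|[] m n|[] m|[] m n|[] m n]; case: s0 => [|[] m0 n0|[] m0 [|n0]|[] m0|[] m0 n0|[] m0 n0];
(* For each pair of shapes, the pairing vanishes by computation, or the counts are incompatible, or
   they force the same parameters. *)
rewrite /scount /=;
first [by move=> _ _ _; right | by move=> *; exfalso; lia
  | by move=> _ _ _; left | by move=> *; left; f_equal; lia].
Qed.

Definition escale (n : int) (d : expo) : expo :=
  let: (a, b, c, u, v, w) := d in (n * a, n * b, n * c, n * u, n * v, n * w).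

Definition e0 : expo := (0, 0, 0, 0, 0, 0).

Section MonomialPowers.
Variable F : comNzRingType.
Local Notation op := (@linop_comp F state).

Lemma mono_exp d (x : linop F state) n : mono d x -> mono (escale n%:Z d) (x ^+ n).
Proof.
move=> dx; elim: n => [|n IHn].
  exists (fun=> 0); rewrite expr0 -linop_comp1; congr op; apply/funext => y.
  case: y d {dx} => -[[[[[x1 x2] x3] x4] x5] x6] k [[[[[d1 d2] d3] d4] d5] d6].
  by rewrite /tr /=; do ?[congr (_, _)]; lia.
rewrite exprSr; have := monoM IHn dx; congr mono.
by case: d {dx IHn} => -[[[[d1 d2] d3] d4] d5] d6 /=; do ?[congr (_, _)]; lia.
Qed.

Lemma mono_zpow d (x y : linop F state) n :
  mono d x -> mono (escale (- 1) d) y -> mono (escale n d) (zpow x y n).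
Proof.
move=> dx dy; case: n => n /=; first exact: mono_exp.
have := mono_exp n.+1 dy; congr mono.
by case: d {dx dy} => -[[[[d1 d2] d3] d4] d5] d6 /=; do ?[congr (_, _)]; lia.
Qed.

Lemma translation_exp (c : int) n :
  op (tr e0 (fun=> c)) ^+ n = op (tr e0 (fun=> c * n%:Z)).
Proof.
rewrite linop_comp_exp; congr op; elim: n => [|n IHn] /=; apply/funext => y.
  by case: y => -[[[[[? ?] ?] ?] ?] ?] k; rewrite /tr /=; do ?[congr (_, _)]; lia.
have := congr1 (fun h => h y) IHn; rewrite /= => ->; case: y => -[[[[[? ?] ?] ?] ?] ?] k.
by rewrite /tr /=; do ?[congr (_, _)]; lia.
Qed.

Lemma translation_zpow (c : int) n :
  zpow (op (tr e0 (fun=> c))) (op (tr e0 (fun=> - c))) n = op (tr e0 (fun=> c * n)).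
Proof.
case: n => n /=; rewrite translation_exp //; congr (op (tr e0 _)).
by apply/funext => _; lia.
Qed.

End MonomialPowers.

(** * Coefficient functionals and injectivity *)

Section Coefficients.
Variable F : numDomainType.
Local Notation E := (linop F state).
Local Notation op := (@linop_comp F state).
Local Notation S := (@linopS F state).

Definition delta (P y : state) : F := (y == P)%:R.

(** Applying an operator to the delta function at [P] and evaluating at the origin reads off the
    coefficient of the monomial [P]; the lower terms do not reach the degree of [P]. *)
Lemma top_coeff (M : 'M[E]_2) d l N P i j : top M d l N -> deg d <= deg P.1 ->
  M i j (delta P) (e0, 0) = (N i j)%:~R * (tr d l (e0, 0) == P)%:R.
Proof.
move=> t dP; rewrite -[M i j](subrK (S (N i j)%:~R * op (tr d l))) linopDE (t i j) ?add0r //.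
move=> z zd; rewrite /delta; case: eqP => // zP; move: zd; rewrite zP /=; lia.
Qed.

Definition Phi (s : sword) (P : state) (M : 'M[E]_2) : F :=
  let: (a, b, c, d) := dual s in let f i j := M i j (delta P) (e0, 0) in
  a%:~R * f ord0 ord0 + b%:~R * f ord0 ord_max + c%:~R * f ord_max ord0
  + d%:~R * f ord_max ord_max.

Lemma Phi_top s P M d l N : top M d l N -> deg d <= deg P.1 ->
  Phi s P M = (pairing (dual s) N)%:~R * (tr d l (e0, 0) == P)%:R.
Proof.
move=> t dP; rewrite /Phi /pairing; case: (dual s) => [[[a b] c] d'].
by rewrite !(top_coeff _ _ t dP) !(intrD, intrM) !mulrDl !mulrA.
Qed.

Lemma PhiD s P M M' : Phi s P (M + M') = Phi s P M + Phi s P M'.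
Proof.
rewrite /Phi; case: (dual s) => [[[a b] c] d]; rewrite !mxE !linopDE !mulrDr.
by do 3!(rewrite [RHS]addrACA; congr (_ + _)).
Qed.

Lemma PhiZ s P c M : Phi s P ((S c)%:M *m M) = c * Phi s P M.
Proof.
rewrite /Phi mul_scalar_mx; case: (dual s) => [[[a b] c'] d]; rewrite !mxE !linopME /=.
by rewrite !mulrDr; do ?congr (_ + _); rewrite mulrCA.
Qed.

Lemma Phi0 s P : Phi s P 0 = 0.
Proof.
by rewrite /Phi; case: (dual s) => [[[a b] c] d]; rewrite !mxE !mulr0 !addr0.
Qed.

End Coefficients.

Lemma seq_max (T : eqType) (f : T -> int) (l : seq T) x : x \in l ->
  exists2 y, y \in l & forall z, z \in l -> f z <= f y.
Proof.
elim: l x => // a l IHl x _; case: l IHl => [_|b l /(_ b (mem_head _ _))[y yl ymax]].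
  by exists a; rewrite ?mem_head // => z; rewrite inE => /eqP->.
have [ay|ya] := leP (f a) (f y).
  exists y; first by rewrite inE yl orbT.
  by move=> z; rewrite inE => /orP[/eqP->//|/ymax].
exists a; first exact: mem_head.
by move=> z; rewrite inE => /orP[/eqP->//|/ymax /le_trans]; apply; apply: ltW.
Qed.

(* Grouping the terms of a formal linear combination by their index. *)
Lemma group_terms (A : pzRingType) (F : comNzRingType) (iota : {rmorphism F -> A})
  (T : eqType) (h : T -> A) (l : seq (F * T)) :
  \sum_(u <- l) iota u.1 * h u.2 =
  \sum_(j <- undup [seq u.2 | u <- l]) iota (\sum_(u <- l | u.2 == j) u.1) * h j.
Proof.
under [RHS]eq_bigr => j _ do rewrite rmorph_sum mulr_suml.
have -> : \sum_(j <- undup [seq u.2 | u <- l]) \sum_(u <- l | u.2 == j) iota u.1 * h j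
    = \sum_(j <- undup [seq u.2 | u <- l]) \sum_(u <- l) (if u.2 == j then iota u.1 * h u.2 else 0).
  apply: eq_bigr => j _; rewrite big_mkcond; apply: eq_bigr => u _.
  by case: eqP => // ->.
rewrite exchange_big /= big_seq [RHS]big_seq; apply: eq_bigr => u ul.
rewrite (bigD1_seq u.2) ?undup_uniq ?mem_undup ?map_f //= eqxx big1 ?addr0 // => j.
by rewrite eq_sym => /negbTE ->.
Qed.

Section Faithful.
Variable R : realType.
Local Notation F := R[i].
Local Notation E := (linop F state).
Local Notation op := (@linop_comp F state).
Local Notation S := (@linopS F state).
Local Notation xgen := (presGen (@xrel R)).
Local Notation hgen := (presGen (@hrel R)).

Variable rho : {rmorphism XQ2 R -> E}.
Hypothesis rhoE : forall g, rho (xgen g) = op (xgen_shift g).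
Hypothesis rhoZ : forall c x, rho (c *: x) = S c * rho x.

Lemma mono_Zh a : mono (vexp a 1) (rho (Zh R a)).
Proof. by rewrite rhoE; eexists. Qed.

Lemma mono_ZhV a : mono (vexp a (- 1)) (rho (ZhV R a)).
Proof. by rewrite rhoE; eexists. Qed.

Lemma mono_rhoM d d' x y : mono d (rho x) -> mono d' (rho y) ->
  mono (eadd d d') (rho (x * y)).
Proof. by rewrite [rho (x * y)]rmorphM; apply: monoM. Qed.

Lemma mono_Z a : mono (vexp a 2) (rho (Z R a)).
Proof.
have := mono_rhoM (mono_Zh a) (mono_Zh a).
by case: a.
Qed.

Lemma mono_ZV a : mono (vexp a (- 2)) (rho (ZV R a)).
Proof.
have := mono_rhoM (mono_ZhV a) (mono_ZhV a).
by case: a.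
Qed.

Lemma rho_xq : rho (xq R) = op (tr e0 (fun=> 8)).
Proof. by rewrite rmorphXn rhoE; have := @translation_exp F 1 8. Qed.

Lemma rho_xqV : rho (xqV R) = op (tr e0 (fun=> - 8)).
Proof. by rewrite rmorphXn rhoE; have := @translation_exp F (- 1) 8. Qed.

Lemma mono_tinf : mono (1, 1, 1, 2, 2, 2) (rho (tinf R)).
Proof.
have m0 : mono e0 (rho (xq R)) by rewrite rho_xq; eexists.
exact: mono_rhoM (mono_rhoM (mono_rhoM (mono_rhoM (mono_rhoM (mono_rhoM m0 (mono_Zh O1)) (mono_Zh B1))
  (mono_Zh G1)) (mono_Z O2)) (mono_Z B2)) (mono_Z G2).
Qed.

Lemma mono_tinfV : mono (- 1, - 1, - 1, - 2, - 2, - 2) (rho (tinfV R)).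
Proof.
have m0 : mono e0 (rho (xq R)) by rewrite rho_xq; eexists.
exact: mono_rhoM (mono_rhoM (mono_rhoM (mono_rhoM (mono_rhoM (mono_rhoM m0 (mono_ZhV O1)) (mono_ZhV B1))
  (mono_ZhV G1)) (mono_ZV O2)) (mono_ZV B2)) (mono_ZV G2).
Qed.

Local Notation img := (hgen_image (Zh R O1) (ZhV R O1) (Zh R B1) (ZhV R B1)
  (Zh R G1) (ZhV R G1) (xq R) (xqV R) (Z R O2) (ZV R O2) (Z R B2) (ZV R B2)
  (Z R G2) (ZV R G2)).
Variable phi : {rmorphism HD4 R -> 'M[XQ2 R]_2}.
Hypothesis phiE : forall h, phi (hgen h) = img h.
Hypothesis phiZ : forall k x, phi (k *: x) = (scalar_of (@xrel R) k)%:M * phi x.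

Local Notation hbas := (hbasis (hK R) (ht R) (fun i => hgen (gTV i)) (hqh R) (hgen gQhV)).
Local Notation hmn := (hmon (ht R) (fun i => hgen (gTV i)) (hqh R) (hgen gQhV)).

Definition Psi (x : HD4 R) : 'M[E]_2 := map_mx rho (phi x).

Lemma PsiM x y : Psi (x * y) = Psi x *m Psi y.
Proof. by rewrite /Psi rmorphM map_mxM. Qed.

Lemma PsiD x y : Psi (x + y) = Psi x + Psi y.
Proof. by rewrite /Psi rmorphD map_mxD. Qed.

Lemma Psi0 : Psi 0 = 0.
Proof. by rewrite /Psi rmorph0 map_mx0. Qed.

Lemma PsiZ c x : Psi (scalar_of (@hrel R) c * x) = (S c)%:M *m Psi x.
Proof.
rewrite scalar_ofE /Psi phiZ map_mxM map_scalar_mx /=; congr (_%:M *m _).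
by rewrite /scalar_of rhoZ rmorph1 mulr1.
Qed.

Local Notation wmxE := (wmx (rho (Zh R O1)) (rho (ZhV R O1)) (rho (Zh R B1)) (rho (ZhV R B1))
  (rho (Zh R G1)) (rho (ZhV R G1)) (rho (Z R O2)) (rho (ZV R O2)) (rho (Z R B2))
  (rho (ZV R B2)) (rho (Z R G2)) (rho (ZV R G2))).

Lemma Psi_word s : Psi (hword (hK R) s) = wmxE s.
Proof.
elim: s => [|x s IHs].
  by rewrite /hword /wmx !big_nil /Psi rmorph1 map_scalar_mx rmorph1.
rewrite hword_cons PsiM IHs /wmx big_cons; congr (_ *m _).
rewrite /Psi /hk /hK phiE /= /Kmx.
by case: x => /=; rewrite inordK //= ?map_Omx ?map_Bmx ?map_Gmx.
Qed.

Lemma Psi_exp x a n : Psi x = a%:M -> Psi (x ^+ n) = (a ^+ n)%:M.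
Proof.
move=> xa; elim: n => [|n IHn]; first by rewrite /Psi rmorph1 map_scalar_mx rmorph1.
by rewrite !exprS PsiM xa IHn -scalar_mxM.
Qed.

Lemma Psi_zpow x y a b n :
  Psi x = a%:M -> Psi y = b%:M -> Psi (zpow x y n) = (zpow a b n)%:M.
Proof. by move=> xa yb; case: n => n; apply: Psi_exp. Qed.

(** The exponent of t_1^a t_2^b t_3^c t_4^d under the map: t_4 involves all six coordinates, doubly
    those of the cycle. *)
Definition pexp (p : int * int * int * int) : expo :=
  let: (a, b, c, d) := p in (a + d, b + d, c + d, 2 * d, 2 * d, 2 * d).

(** The function [L] does not depend on [e]: q only adds 8 to the exponent of q^{1/8}, so [e] can be
    recovered from the shift. *)
Lemma Psi_hmon : exists L : int * int * int * int -> expo -> int, forall p e,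
  Psi (hmn (p, e)) = (op (tr (pexp p) (fun x => L p x + 8 * e)))%:M.
Proof.
pose z (p : int * int * int * int) := let: (a, b, c, d) := p in
  zpow (rho (Zh R O1)) (rho (ZhV R O1)) a * (zpow (rho (Zh R B1)) (rho (ZhV R B1)) b *
  (zpow (rho (Zh R G1)) (rho (ZhV R G1)) c * zpow (rho (tinf R)) (rho (tinfV R)) d)).
have zmono p : mono (pexp p) (z p).
  case: p => -[[a b] c] d; rewrite /z.
  have := monoM (mono_zpow a (mono_Zh O1) (mono_ZhV O1))
    (monoM (mono_zpow b (mono_Zh B1) (mono_ZhV B1))
    (monoM (mono_zpow c (mono_Zh G1) (mono_ZhV G1)) (mono_zpow d mono_tinf mono_tinfV))).
  by congr mono; rewrite /=; do ?[congr (_, _)]; lia.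
have [L LE] := choice zmono.
exists L => p e; have {zmono} := LE p; case: p => -[[a b] c] d; rewrite /z => zE.
have tI i : Psi (ht R i) = (rho (tpar (Zh R O1) (Zh R B1) (Zh R G1) (xq R) (Z R O2) (Z R B2) (Z R G2) i))%:M.
  by rewrite /Psi phiE /= map_scalar_mx.
have tVI i : Psi (hgen (gTV i)) = (rho (tparV (ZhV R O1) (ZhV R B1) (ZhV R G1) (xq R) (ZV R O2) (ZV R B2) (ZV R G2) i))%:M.
  by rewrite /Psi phiE /= map_scalar_mx.
have qI : Psi (hqh R) = (op (tr e0 (fun=> 8)))%:M.
  by rewrite /Psi phiE /= map_scalar_mx /= rho_xq.
have qVI : Psi (hgen gQhV) = (op (tr e0 (fun=> - 8)))%:M.
  by rewrite /Psi phiE /= map_scalar_mx /= rho_xqV.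
rewrite /hmon !PsiM !(Psi_zpow _ (tI _) (tVI _)) (Psi_zpow _ qI qVI) translation_zpow.
rewrite /tpar /tparV /ltr_ord !inordK //= -!scalar_mxM; congr (_%:M).
rewrite !mulrA; rewrite !mulrA in zE.
rewrite zE linop_compM tr_comp; congr (op (tr _ _)).
by rewrite /=; do ?[congr (_, _)]; lia.
Qed.

Lemma Psi_basis_top : exists (N : sword -> int)
  (L : int * int * int * int -> expo -> int) (Ls : sword -> expo -> int),
  (forall s, N s = 1 \/ N s = - 1) /\
  forall p e s, top (Psi (hbas (p, e, s))) (eadd (pexp p) (wexp (sword_seq s)))
    (fun x => L p x + 8 * e + Ls s (eadd x (pexp p))) (fun i j => N s * smat s i j).
Proof.
have [L LE] := Psi_hmon.
have wtop x s := @wmx_top F _ _ _ _ _ _ _ _ _ _ _ _ (mono_Zh O1) (mono_ZhV O1)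
  (mono_Zh B1) (mono_ZhV B1) (mono_Zh G1) (mono_ZhV G1) (mono_Z O2) (mono_ZV O2)
  (mono_Z B2) (mono_ZV B2) (mono_Z G2) (mono_ZV G2) x s.
have {wtop} [N Nt] := choice (sword_top wtop).
have {Nt} [N1 Nt] : (forall s, N s = 1 \/ N s = - 1) /\ forall s,
    has_top (wmxE (sword_seq s)) (wexp (sword_seq s)) (fun i j => N s * smat s i j).
  by split=> s; have [] := Nt s.
have [Ls Lt] := choice Nt.
exists N, L, Ls; split=> // p e s; rewrite /hbasis /= PsiM LE Psi_word.
set l := fun x => L p x + 8 * e.
have mtop : top (op (tr (pexp p) l))%:M (pexp p) l (fun i j => (i == j)%:Z).
  move=> i j; rewrite mxE; case: (i == j); rewrite ?mulr1n ?mulr0n /=.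
    by rewrite mulr1z rmorph1 mul1r subrr; apply: filt0.
  by rewrite mulr0z rmorph0 mul0r subr0; apply: filt0.
have := top_mul mtop (Lt s); congr top; apply/funext => i; apply/funext => j.
by elim/I2P: i => /=; rewrite !(mul1r, mul0r, add0r, addr0).
Qed.

(** At an index of maximal degree with nonzero coefficient, the dual functional at its leading
    monomial sees this term alone. *)
Lemma Psi_injective x :
  hspan (hK R) (ht R) (fun i => hgen (gTV i)) (hqh R) (hgen gQhV) (scalar_of (@hrel R)) x ->
  Psi x = 0 -> x = 0.
Proof.
move=> [l ->]; rewrite group_terms; set C := fun j => \sum_(u <- l | u.2 == j) u.1.
set J := undup _ => Psi_x0.
have [N [L [Ls [N1 topj]]]] := Psi_basis_top.
pose Dj (j : hindex) := eadd (pexp j.1.1) (wexp (sword_seq j.2)).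
(* The state to which the leading monomial of the basis element moves the origin. *)
pose Pj (j : hindex) : state :=
  tr (Dj j) (fun x => L j.1.1 x + 8 * j.1.2 + Ls j.2 (eadd x (pexp j.1.1))) (e0, 0).
have Pj1 j : (Pj j).1 = Dj j.
  rewrite /Pj /=; case: (Dj j) => -[[[[x1 x2] x3] x4] x5] x6.
  by rewrite /=; do ?[congr (_, _)]; lia.
have jtop j : top (Psi (hbas j)) (Dj j)
    (fun x => L j.1.1 x + 8 * j.1.2 + Ls j.2 (eadd x (pexp j.1.1)))
    (fun i k => N j.2 * smat j.2 i k).
  by case: j => -[p e] s; apply: topj.
have pairN q s : pairing q (fun i k => N s * smat s i k) = N s * pairing q (smat s).
  by case: q => -[[a b] c] d; rewrite /pairing; ring.
have PhiE j j0 : deg (Dj j) <= deg (Dj j0) ->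
    Phi j0.2 (Pj j0) (Psi (hbas j)) =
    (N j.2 * pairing (dual j0.2) (smat j.2))%:~R * (Pj j == Pj j0)%:R.
  by move=> le; rewrite (Phi_top _ (jtop j)) ?Pj1 // pairN.
have Phi_diag j : Phi j.2 (Pj j) (Psi (hbas j)) != 0.
  rewrite PhiE // eqxx mulr1 intr_eq0 mulf_neq0 ?dual_self //.
  by case: (N1 j.2) => ->.
have Phi_off j j0 : deg (Dj j) <= deg (Dj j0) -> j != j0 ->
    Phi j0.2 (Pj j0) (Psi (hbas j)) = 0.
  move=> le nj; rewrite PhiE //; have [P|] := eqVneq (Pj j) (Pj j0); last by rewrite mulr0.
  suff -> : pairing (dual j0.2) (smat j.2) = 0 by rewrite mulr0 mul0r.
  have D : Dj j = Dj j0 by rewrite -!Pj1 P.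
  move: P; rewrite /Pj D => -[] /eqP; rewrite eq_sym => P.
  case: j j0 nj D P {le} => -[[[[a b] c] d] e] s [[[[[a' b'] c'] d'] e'] s'] /= nj D P.
  (* Equal states have equal exponents, so the letter counts agree up to the exponents [d], [d'] of
     t_4. If the words coincide, the exponents give back a, b, c, d and the power of q gives back
     [e]. *)
  have [ss|//] : s = s' \/ pairing (dual s') (smat s) = 0.
    apply: (dual_orth (d := d) (d0 := d')) => y; rewrite -!count_sword.
    by move: D; rewrite /Dj /= => -[_ _ _]; case: y; lia.
  case/eqP: nj; move: D P; rewrite {}ss /Dj /= => -[].
  move=> Da Db Dc Dd _ _; have {}Dd : d = d' by lia.
  have -> : a = a' by lia.
  have -> : b = b' by lia.
  have -> : c = c' by lia.
  by rewrite Dd => /eqP P; congr (_, _, _); lia.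
have C0 j : j \in J -> C j = 0.
  move=> jJ; apply/eqP; apply: contraT => Cj.
  have : j \in [seq i <- J | C i != 0] by rewrite mem_filter Cj.
  move=> /(seq_max (fun i => deg (Dj i)))[j0]; rewrite mem_filter => /andP[Cj0 j0J] jmax.
  have : Phi j0.2 (Pj j0) (Psi (\sum_(i <- J) scalar_of (@hrel R) (C i) * hbas i)) = 0.
    by rewrite Psi_x0 Phi0.
  rewrite (big_morph Psi PsiD Psi0) (big_morph _ (@PhiD F j0.2 (Pj j0)) (@Phi0 F j0.2 (Pj j0))).
  rewrite (bigD1_seq j0) ?undup_uniq //= big_seq_cond big1 => [|i /andP[iJ ij0]].
    by rewrite addr0 PsiZ PhiZ => /eqP; rewrite mulf_eq0 (negPf Cj0) (negPf (Phi_diag _)).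
  rewrite PsiZ PhiZ; have [->|Ci] := eqVneq (C i) 0; first by rewrite mul0r.
  by rewrite Phi_off ?mulr0 //; apply: jmax; rewrite mem_filter Ci.
by rewrite big_seq big1 // => j /C0; rewrite /C => ->; rewrite rmorph0 mul0r.
Qed.

End Faithful.

(** * Assembly of the theorem *)

(** The span contains 1 and is stable under left multiplication by every generator, hence is
    everything. *)
Lemma HD4_span (R : realType) (x : HD4 R) :
  hspan (hK R) (ht R) (fun i => presGen (@hrel R) (gTV i)) (hqh R)
    (presGen (@hrel R) gQhV) (scalar_of (@hrel R)) x.
Proof.
have [h1 hK ht hq] := hspan_generators
  (K := hK R) (t := ht R) (tV := fun i => presGen (@hrel R) (gTV i))
  (q := hqh R) (qV := presGen (@hrel R) gQhV)
  (fun i => presGen_mul1 (hrel_TTV R i)) (fun i => presGen_mul1 (hrel_TVT R i))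
  (presGen_mul1 (hrel_QQV R)) (presGen_mul1 (hrel_QVQ R))
  (fun i => presGen_central (hrel_Tcentral R i)) (presGen_central (hrel_Qcentral R))
  (fun i => presGen_Hecke (hrel_Hecke R i)) (presGen_mul4 (hrel_prod R))
  (scalar_of_central (rel := @hrel R)).
elim/presAlg_ind: x => [||x y hx hy|c x hx|g x hx].
- exact: hspan0.
- exact: h1.
- exact: hspanD.
- by rewrite -scalar_ofE; apply: hspan_iota.
- case: g => [i|i|i||]; first exact: hK.
  + exact: (ht i x hx).1.
  + exact: (ht i x hx).2.
  + exact: (hq x hx).1.
  + exact: (hq x hx).2.
Qed.

Theorem theorem4p3 (R : realType) :
  [/\ \det (Obar R) = 1, \det (Bbar R) = 1, \det (Gbar R) = 1
    & \det (Pbar R) = 1]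
  /\
  [/\ (Obar R - (Zh R O1)%:M) *m (Obar R - (ZhV R O1)%:M) = 0,
      (Bbar R - (Zh R B1)%:M) *m (Bbar R - (ZhV R B1)%:M) = 0,
      (Gbar R - (Zh R G1)%:M) *m (Gbar R - (ZhV R G1)%:M) = 0,
      (Pbar R - (tinf R)%:M) *m (Pbar R - (tinfV R)%:M) = 0
    & Obar R *m Bbar R *m Gbar R *m Pbar R = (xqV R)%:M]
  /\
  exists phi : {rmorphism HD4 R -> 'M[XQ2 R]_2},
    [/\ forall (c : R[i]) (h : HD4 R),
          phi (c *: h) = map_mx (fun x => c *: x) (phi h),
        [/\ phi (hK R (inord 0)) = Obar R,
            phi (hK R (inord 1)) = Bbar R,
            phi (hK R (inord 2)) = Gbar R
          & phi (hK R (inord 3)) = Pbar R],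
        [/\ phi (ht R (inord 0)) = (Zh R O1)%:M,
            phi (ht R (inord 1)) = (Zh R B1)%:M,
            phi (ht R (inord 2)) = (Zh R G1)%:M
          & phi (ht R (inord 3)) = (tinf R)%:M],
        phi (hqh R) = (xq R)%:M
      & injective phi].
Proof.
have [dets [rels [phi [phiE phiZ]]]] := torus_representation R.
split=> //; split=> //; exists phi.
have [rho rhoE rhoZ] := torus_operators R.
split.
- move=> c h; rewrite phiZ -[_ * _]/(_ *m _) mul_scalar_mx; apply/matrixP => i j.
  by rewrite !mxE scalar_ofE.
- by split; rewrite phiE /= /Kmx inordK.
- by split; rewrite phiE /= /tpar inordK.
- by rewrite phiE.
(* Injectivity is reduced to the kernel and tested after applying the torus representation
   entrywise. *)
- move=> x y xy; apply/eqP; rewrite -subr_eq0; apply/eqP.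
  apply: (Psi_injective rhoE rhoZ phiE phiZ); first exact: HD4_span.
  by rewrite /Psi rmorphB xy subrr map_mx0.
Qed.
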